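(* Let $G$ be a simple $\theta$-graph of order $n\geq 4$. Then $\alpha(G)\geq\alpha(C_{n})$. Moreover, (i) if $n$ is odd and $\alpha(G)=\alpha(C_n)$, then $G \cong H_{1}(i)$ for some $1\leq i\leq \frac{n-3}{2}$; (ii) if $n$ is even and $\alpha(G)=\alpha(C_n)$, then $G \cong H_{2}(i)$ for some $1\leq i\leq \frac{n-2}{2}$, or $G \cong H_{3}(i)$ for some $1\leq i\leq \frac{n-4}{2}$. Here the graphs $H_1(i), H_2(i), H_3(i)$ have order $n$.
   Context: All graphs are finite, connected, undirected and simple (no loops, no multiple edges). The order of a graph is its number of vertices. Algebraic connectivity: for a graph $G$ of order $n$, the Laplacian matrix is $L(G)=D(G)-A(G)$, where $A(G)$ is the adjacency matrix and $D(G)$ is the diagonal matrix of vertex degrees. Its eigenvalues, counted with multiplicity, are $\mu_1(G)\ge \mu_2(G)\ge\cdots\ge\mu_{n-1}(G)\ge\mu_n(G)=0$, and $\alpha(G)=\mu_{n-1}(G)$ is the algebraic connectivity (the second smallest Laplacian eigenvalue). $\theta$-graph: two paths from $u$ to $v$ are inner disjoint if their only common vertices are $u$ and $v$. For distinct vertices $u,v$, $p(u,v)$ denotes the maximum number of pairwise inner disjoint paths from $u$ to $v$. A nontrivial graph (at least two vertices) is 2-connected if $p(u,v)\ge 2$ for any two distinct vertices $u,v$. A $\theta$-graph is a 2-connected graph which consists of three pairwise inner disjoint paths with common initial and terminal vertices (the initial and terminal vertices being distinct; since graphs are simple, at most one of the three paths is a single edge). $C_n=v_0v_1v_2\cdots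 v_{n-1}v_0$ is the cycle with $n$ vertices. $G+uv$ denotes the graph obtained from $G$ by adding the edge $uv$ between two nonadjacent vertices $u,v$ of $G$. - For odd $n\ge 5$ and $1\le i\le\frac{n-3}{2}$: $H_1(i)=C_n+v_{i}v_{n-i}$. - For even $n\ge 4$ and $1\le i\le\frac{n-2}{2}$: $H_2(i)=C_n+v_{i}v_{n-i}$. - For even $n\ge 6$ and $1\le i\le\frac{n-4}{2}$: $H_3(i)=C_n+v_{i}v_{n-i-1}$. *)

(* Defs.v *)
From mathcomp Require Import all_boot all_order all_algebra.
From mathcomp Require Import polyrcf reals.

Set Implicit Arguments.
Unset Strict Implicit.
Unset Printing Implicit Defensive.

Import Order.TTheory GRing.Theory Num.Theory.

Record sgraph := SGraph {
  vertex :> finType;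
  adj : rel vertex;
  adj_sym : symmetric adj;
  adj_irrefl : irreflexive adj
}.

Definition isomorphic (G H : sgraph) : Prop :=
  exists2 f : G -> H, bijective f & {mono f : x y / adj x y}.

Section Spectrum.
Local Open Scope ring_scope.
Variables (R : realType) (G : sgraph).

Definition adjacency_mx : 'M[R]_#|G| :=
  \matrix_(i, j) (adj (enum_val i : G) (enum_val j))%:R.

Definition degree_mx : 'M[R]_#|G| :=
  diag_mx (\row_i #|[set y : G | adj (enum_val i) y]|%:R).

Definition laplacian_mx : 'M[R]_#|G| := degree_mx - adjacency_mx.

(* Entry k of this nonincreasing list is mu_(k+1)(G). Only real roots are      *)
(* listed; as the Laplacian is symmetric these are all its eigenvalues.        *)
Definition laplacian_eigenvalues : seq R :=
  let p := char_poly laplacian_mx in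
  sort >=%R (flatten [seq nseq (mup x p) x | x <- rootsR p]).

Definition algebraic_connectivity : R := laplacian_eigenvalues`_(#|G| - 2).

End Spectrum.

Section Theta.
Variable G : sgraph.
Implicit Types (u v x y : G) (p q : seq G).

(* A path is given by the full sequence of its vertices, endpoints included.   *)
Definition is_path u v p : bool :=
  if p is x :: q then
    [&& x == u, path (@adj G) x q, last x q == v & uniq (x :: q)]
  else false.

Definition inner_disjoint u v p q : bool :=
  all (fun x => (x \in q) ==> ((x == u) || (x == v))) p.

Definition path_edge p x y : bool :=
  ((x, y) \in zip p (behead p)) || ((y, x) \in zip p (behead p)).

(* A path has at most #|G| vertices, so the paths form a finite type.          *)
Definition path_number u v : nat :=
  \max_(P : {set #|G|.-bseq G} |
        [forall p in P, is_path u v p] &&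
        [forall p in P, forall q in P, (p != q) ==> inner_disjoint u v p q])
    #|P|.

Definition two_connected : Prop :=
  1 < #|G| /\ forall u v, u != v -> 2 <= path_number u v.

(* Distinctness must be required separately: a path consisting of a single     *)
(* edge is inner disjoint from itself.                                         *)
Definition theta_graph : Prop :=
  two_connected /\
  exists u v p1 p2 p3,
    [/\ u != v,
        [/\ is_path u v p1, is_path u v p2 & is_path u v p3],
        [/\ p1 != p2, p1 != p3 & p2 != p3],
        [/\ inner_disjoint u v p1 p2, inner_disjoint u v p1 p3
          & inner_disjoint u v p2 p3]
      & (forall x, [|| x \in p1, x \in p2 | x \in p3]) /\
        (forall x y, adj x y ->
           [|| path_edge p1 x y, path_edge p2 x y | path_edge p3 x y])].

End Theta.

Definition add_edge_rel (G : sgraph) (u v : G) : rel G :=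
  fun x y => adj x y ||
    (x != y) && ((x == u) && (y == v) || (x == v) && (y == u)).

Lemma add_edge_sym (G : sgraph) (u v : G) : symmetric (add_edge_rel u v).
Proof.
move=> x y; rewrite /add_edge_rel adj_sym (eq_sym x y); congr (_ || _ && _).
by rewrite orbC (andbC (x == v)) (andbC (x == u)).
Qed.

Lemma add_edge_irrefl (G : sgraph) (u v : G) : irreflexive (add_edge_rel u v).
Proof. by move=> x; rewrite /add_edge_rel adj_irrefl eqxx. Qed.

Definition add_edge (G : sgraph) (u v : G) : sgraph :=
  SGraph (add_edge_sym u v) (add_edge_irrefl u v).

Definition cycle_rel (n : nat) : rel 'I_n :=
  fun i j => (i != j) && ((j == ordS i) || (i == ordS j)).

Lemma cycle_sym n : symmetric (@cycle_rel n).
Proof. by move=> i j; rewrite /cycle_rel eq_sym orbC. Qed.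

Lemma cycle_irrefl n : irreflexive (@cycle_rel n).
Proof. by move=> i; rewrite /cycle_rel eqxx. Qed.

(* This is the cycle on n vertices when n >= 3.                                *)
Definition cycle_graph (n : nat) : sgraph :=
  SGraph (@cycle_sym n) (@cycle_irrefl n).

(* C_n + v_a v_b, for a, b < n.                                                *)
Definition cycle_chord (n a b : nat) : sgraph :=
  if n is m.+1 then
    @add_edge (cycle_graph m.+1) (inord a : 'I_m.+1) (inord b : 'I_m.+1)
  else cycle_graph 0.

Definition H1 (n i : nat) : sgraph := cycle_chord n i (n - i).
Definition H2 (n i : nat) : sgraph := cycle_chord n i (n - i).
Definition H3 (n i : nat) : sgraph := cycle_chord n i (n - i - 1).

(* Main.v *)
Require Import Defs.
From mathcomp Require Import all_boot all_order all_algebra.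
From mathcomp Require Import reals polyrcf complex spectral.
From mathcomp Require Import zify ring lra.

(** Why the theorem holds.

    Let alpha = alpha(G), and let f be an eigenvector of alpha orthogonal to
    the constants.  Sort the values of f as h_0 <= ... <= h_(n-1) and put
    d_k = h_k - h_(k-1).  Expanding each difference h_i - h_j into gaps, the
    Dirichlet form of f becomes

      sum over adjacent (x, y) of (f x - f y)^2 = sum_(k, l) d_k d_l c_(k, l),

    where c_(k, l) counts the adjacent pairs separated both by the k-th and by
    the l-th gap (dirichlet_gaps).  In a graph without cut vertex, on at least
    three vertices, two edges or more cross every gap, and at least one edge
    jumps over any given inner vertex of the sorted order (zigzag_cut_le).  The
    zigzag cycle 0 - 2 - 4 - ... - 5 - 3 - 1 - 0 has no more than that
    (cut2_zigzag), so sorting f along it can only decrease the Dirichlet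
    form.  The zigzag cycle is a copy of C_n, and alpha(C_n) is the
    least Rayleigh quotient on vectors of sum zero; hence
    alpha(C_n) <= alpha(G) for every G without cut vertex, in particular for
    every theta-graph (two_connected_no_cut_vertex).

    Suppose alpha(G) = alpha(C_n).  Then h is an eigenvector of the zigzag
    cycle, and the eigenvalue equation forbids three consecutive equal values
    (sorted_eigen_no_plateau).  Moreover the two counts agree at every pair of
    nonzero gaps.  Counting the edges that leave the tie class of a vertex u,
    which is {u} or {u, y}, gives degree 2 for u in the first case, and
    deg u + deg y = 4 + 2 [u adjacent to y] in the second one (or 2 in place
    of 4 at the two ends of the order).  So a vertex of degree 3 has a
    neighbour of degree 3 (degree3_neighbour, connectivity_vs_cycle).  In a
    theta-graph the branch vertices are the only ones of degree 3, and they
    are adjacent only if one of the three paths is a single edge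
    (branch_degree).  In that case the other two paths form a Hamiltonian cycle
    and G is C_n plus a chord (chord_walk_isomorphic); the parities of the two
    arcs cut off by the chord tell which of H_1, H_2, H_3 it is.

    The variational description of alpha (algebraic_connectivity_spectrum)
    comes from a unitary diagonalization of the Laplacian over the complex
    numbers. *)

Set Implicit Arguments.
Unset Strict Implicit.
Unset Printing Implicit Defensive.
Import Order.TTheory GRing.Theory Num.Theory.

(** * Second smallest eigenvalue of a symmetric matrix *)

Section Spectral.
Local Open Scope ring_scope.
Local Open Scope sesquilinear_scope.
Variable (R : rcfType).
Notation toC := (real_complex R).

Lemma symmetric_spectral n (A : 'M[R]_n) : A^T = A ->
  exists P : 'M[R[i]]_n, exists2 d : 'rV[R]_n, P \is unitarymx &
    map_mx toC A = P^t* *m diag_mx (map_mx toC d) *m P.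
Proof.
move=> Asym; set B := map_mx toC A.
have Bherm : B \is hermsymmx.
  apply: realsym_hermsym.
    by apply/is_hermitianmxP; rewrite expr0 scale1r map_mx_id // map_trmx Asym.
  by apply/mxOverP=> i j; rewrite mxE complex_real.
exists (spectralmx B), (map_mx (@complex.Re R) (spectral_diag B)).
  exact: spectral_unitarymx.
rewrite -invmx_unitary ?spectral_unitarymx // -map_mx_comp.
have -> : map_mx (toC \o @complex.Re R) (spectral_diag B) = spectral_diag B.
  have /mxOverP dreal := hermitian_spectral_diag_real Bherm.
  by apply/matrixP=> i j; rewrite mxE /= RRe_real.
exact/orthomx_spectralP/hermitian_normalmx.
Qed.

Lemma similar_diag_char_poly n (A : 'M[R]_n) (P : 'M[R[i]]_n) (d : 'rV[R]_n) :
  P \is unitarymx -> map_mx toC A = P^t* *m diag_mx (map_mx toC d) *m P ->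
  char_poly A = \prod_i ('X - (d 0 i)%:P).
Proof.
move=> Pu defA; apply: (map_poly_inj toC).
rewrite map_char_poly defA.
have PtP : P^t* *m P = 1%:M by rewrite -invmx_unitary // mulVmx // unitarymx_unit.
have detP : \det (map_mx polyC (P^t*)) * \det (map_mx polyC P) = 1.
  by rewrite -det_mulmx -map_mxM PtP map_mx1 det1.
have -> : char_poly (P^t* *m diag_mx (map_mx toC d) *m P) =
          char_poly (diag_mx (map_mx toC d)).
  rewrite /char_poly /char_poly_mx !map_mxM.
  have XE : 'X%:M = map_mx polyC (P^t*) *m 'X%:M *m map_mx polyC P.
    by rewrite scalar_mxC -mulmxA -map_mxM PtP map_mx1 mulmx1.
  by rewrite [in LHS]XE -mulmxBl -mulmxBr !det_mulmx mulrAC detP mul1r.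
rewrite char_poly_trig ?diag_mx_is_trig // rmorph_prod.
by apply: eq_bigr => i _; rewrite rmorphB /= map_polyX map_polyC !mxE eqxx.
Qed.

(** The list of real roots repeated with multiplicity, in the form used by
    [laplacian_eigenvalues], recovers the roots of a split polynomial. *)
Lemma real_roots_perm (s : seq R) :
  perm_eq (flatten [seq nseq (mup x (\prod_(x <- s) ('X - x%:P))) x
                   | x <- rootsR (\prod_(x <- s) ('X - x%:P))]) s.
Proof.
set p := \prod_(x <- s) _.
have p0 : p != 0 by rewrite monic_neq0 ?monic_prod_XsubC.
apply/allP => x _ /=; rewrite count_flatten -map_comp /=.
have -> : count_mem x s = mup x p by rewrite mu_prod_XsubC.
rewrite (eq_map (g := fun y => if y == x then mup x p else 0%N)); last first.
  by move=> y /=; rewrite count_nseq /=; case: eqP => [->|_]; rewrite ?mul1n ?mul0n.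
rewrite sumnE big_map.
have xin : (x \in rootsR p) = root p x.
  by rewrite -roots_on_rootsR // in_itv.
have [xr|xr] := boolP (root p x); last first.
  rewrite mupNroot // big1_seq // => y /andP[_]; rewrite -roots_on_rootsR //.
  by case/andP=> _ yr; case: eqP => // eyx; rewrite -eyx yr in xr.
rewrite -big_mkcond (big_rem x) /= ?xin // eqxx.
rewrite big1_seq ?addn0 // => y /andP[/eqP->].
by rewrite mem_rem_uniqF // uniq_roots.
Qed.

(** The entry of index n - 2 of a nonincreasing list of length n is the second
    smallest value: some index j0 carries a smallest value, and j1 minimizes d
    away from j0. *)
Lemma sort_second_smallest n (d : 'I_n -> R) : (1 < n)%N ->
  exists j0 j1, [/\ j0 != j1, d j1 = (sort >=%R [seq d i | i <- enum 'I_n])`_(n - 2),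
    d j0 <= d j1 & forall i, i != j0 -> d j1 <= d i].
Proof.
move=> n1; set e := sort (relpre d >=%R) (enum 'I_n).
have -> : sort >=%R [seq d i | i <- enum 'I_n] = [seq d i | i <- e].
  by rewrite sort_map.
have se : size e = n by rewrite size_sort size_enum_ord.
have ue : uniq e by rewrite sort_uniq enum_uniq.
have i0 : 'I_n by exact: Ordinal (ltnW n1).
have esort : forall i j, (i <= j < n)%N -> d (nth i0 e j) <= d (nth i0 e i).
  move=> i j /andP[ij jn].
  have tot : total (relpre d >=%R) by move=> x y; exact: le_total.
  have := sort_sorted tot (enum 'I_n); rewrite -/e => so.
  apply: (sorted_leq_nth _ _ i0 so) => //; rewrite ?inE ?se //.
  - by move=> x y z /= h1 h2; exact: le_trans h2 h1.
  - by move=> x /=.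
  - exact: leq_ltn_trans ij jn.
have [n1n n2n] : (n.-1 < n)%N /\ (n - 2 < n)%N by lia.
exists (nth i0 e n.-1), (nth i0 e (n - 2)); split.
- by rewrite nth_uniq ?se //; lia.
- by rewrite (nth_map i0) ?se.
- by apply: esort; lia.
- move=> i; have : i \in e by rewrite mem_sort mem_enum.
  move=> /(nthP i0)[k]; rewrite se => kn <-; rewrite nth_uniq ?se // => kne.
  by apply: esort; lia.
Qed.

Section SecondEigenvalue.
Variables (n : nat) (A : 'M[R]_n) (P : 'M[R[i]]_n) (d : 'rV[R]_n).
Hypotheses (Pu : P \is unitarymx)
  (defA : map_mx toC A = P^t* *m diag_mx (map_mx toC d) *m P)
  (psd : forall g : 'cV[R]_n, 0 <= (g^T *m A *m g) 0 0)
  (A1 : A *m const_mx 1 = 0 :> 'cV_n).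

Let PtP : P^t* *m P = 1%:M.
Proof. by rewrite -invmx_unitary // mulVmx // unitarymx_unit. Qed.

Let PPt : P *m P^t* = 1%:M.
Proof. exact/unitarymxP. Qed.

(** The diagonal entries are roots of the characteristic polynomial, hence
    eigenvalues over R; a real eigenvector makes the form [psd] available. *)
Lemma spectral_value_ge0 i : 0 <= d 0 i.
Proof.
have : root (char_poly A) (d 0 i).
  rewrite (similar_diag_char_poly Pu defA) (bigD1 i) //= rootM root_XsubC.
  by rewrite eqxx.
rewrite -eigenvalue_root_char => /eigenvalueP[v vA v0].
have := psd v^T; rewrite trmxK vA -scalemxAl mxE.
have vv : 0 < (v *m v^T) 0 0.
  rewrite mxE; under eq_bigr => k _ do rewrite mxE -expr2.
  rewrite lt_neqAle sumr_ge0 ?andbT => [|k _]; last exact: sqr_ge0.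
  apply: contraNneq v0 => /esym/psumr_eq0P h; apply/eqP/rowP=> k.
  by rewrite mxE; apply/eqP; rewrite -sqrf_eq0 h // => j _; exact: sqr_ge0.
by rewrite pmulr_lge0.
Qed.

Let coord (g : 'cV[R]_n) := P *m map_mx toC g.

Lemma shifted_coord a (g : 'cV[R]_n) :
  map_mx toC (A *m g - a *: g) =
  P^t* *m (\col_i (toC (d 0 i - a) * coord g i 0)).
Proof.
rewrite map_mxB map_mxM map_mxZ defA.
have -> : \col_i (toC (d 0 i - a) * coord g i 0) =
   diag_mx (map_mx toC d) *m coord g - toC a *: coord g.
  by apply/colP=> i; rewrite mul_diag_mx !mxE rmorphB mulrBl.
by rewrite mulmxBr -scalemxAr /coord !mulmxA PtP mul1mx.
Qed.

(** Parseval in the unitary coordinates; h enters through its coordinates y. *)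
Lemma coord_dot (g h : 'cV[R]_n) (y : 'cV[R[i]]_n) : map_mx toC h = P^t* *m y ->
  toC ((g^T *m h) 0 0) = \sum_i ((coord g i 0)^* * y i 0).
Proof.
move=> hy.
have -> : toC ((g^T *m h) 0 0) = (map_mx toC (g^T *m h)) 0 0 by rewrite [RHS]mxE.
rewrite map_mxM hy mulmxA.
have -> : map_mx toC g^T *m P^t* = (coord g)^t*.
  rewrite /coord trmx_mul map_mxM; congr (_ *m _).
  by apply/rowP=> i; rewrite !mxE; exact/esym/conjc_real.
by rewrite mxE; apply: eq_bigr => i _; rewrite !mxE.
Qed.

Variables (j0 j1 : 'I_n).
Hypotheses (j01 : j0 != j1) (dj01 : d 0 j0 <= d 0 j1)
  (dj1 : forall i, i != j0 -> d 0 j1 <= d 0 i).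

Let z := coord (const_mx 1).

Let dz i : d 0 i != 0 -> z i 0 = 0.
Proof.
move=> di0.
have := shifted_coord 0 (const_mx 1); rewrite A1 scale0r subr0 map_mx0.
move/(congr1 (mulmx P)); rewrite mulmx0 mulmxA PPt mul1mx => /colP/(_ i).
rewrite !mxE subr0 => /esym/eqP; rewrite mulf_eq0.
by rewrite (fmorph_eq0 toC) (negPf di0) => /eqP.
Qed.

Let z0 : z != 0.
Proof.
apply: contraNneq (oner_neq0 R) => ze.
have : map_mx toC (const_mx 1 : 'cV[R]_n) = 0.
  by rewrite -[LHS]mul1mx -PtP -mulmxA -/(coord _) -/z ze mulmx0.
move/colP/(_ j0); rewrite !mxE => h; apply/eqP; apply: complexI; exact: h.
Qed.

(** Only the coordinate j0 can lie below d j1.  If it does, d j1 > 0, so the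
    constant vector, which is in the kernel, is supported at j0 in the spectral
    coordinates, and a vector orthogonal to it has no j0 component. *)
Lemma spectral_gap_term (g : 'cV[R]_n) i : \sum_j g j 0 = 0 ->
  0 <= (coord g i 0)^* * (toC (d 0 i - d 0 j1) * coord g i 0).
Proof.
move=> g0.
have [->|ij] := eqVneq i j0; last first.
  rewrite mulrCA mulr_ge0 //; last by rewrite mulrC mul_conjC_ge0.
  by rewrite -[0]/(toC 0) lecR subr_ge0 dj1.
move: dj01; rewrite le_eqVlt => /predU1P[->|lt01].
  by rewrite subrr mul0r mulr0.
have zj i' : i' != j0 -> z i' 0 = 0.
  move=> /dj1 h; apply: dz; rewrite gt_eqF //.
  by rewrite (lt_le_trans _ h) // (le_lt_trans _ lt01) // spectral_value_ge0.
have zj0 : z j0 0 != 0.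
  apply: contraNneq z0 => e; apply/eqP/colP=> k; rewrite [RHS]mxE.
  by have [->//|/zj] := eqVneq k j0.
have := @coord_dot g (const_mx 1) z.
rewrite /z /coord mulmxA PtP mul1mx => /(_ erefl).
have -> : (g^T *m (const_mx 1 : 'cV[R]_n)) 0 0 = 0.
  by rewrite mxE -[RHS]g0; apply: eq_bigr => k _; rewrite !mxE mulr1.
rewrite -/(coord _) -/z (bigD1 j0) //= big1 => [|k /zj ->]; last by rewrite mulr0.
rewrite addr0 => /esym/eqP; rewrite mulf_eq0 (negPf zj0) orbF => /eqP->.
by rewrite mul0r.
Qed.

Lemma gap_form (g : 'cV[R]_n) a :
  toC ((g^T *m (A *m g - a *: g)) 0 0) =
  \sum_i (coord g i 0)^* * (toC (d 0 i - a) * coord g i 0).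
Proof.
rewrite (coord_dot _ (shifted_coord _ _)); apply: eq_bigr => i _.
by congr (_ * _); rewrite [LHS]mxE.
Qed.

Lemma second_eigenvalue_le (g : 'cV[R]_n) : \sum_j g j 0 = 0 ->
  0 <= (g^T *m (A *m g - d 0 j1 *: g)) 0 0.
Proof.
move=> g0; rewrite -lecR gap_form sumr_ge0 // => i _.
exact: spectral_gap_term.
Qed.

(** A sum of nonnegative terms that vanishes vanishes termwise: each spectral
    component of g belongs to the eigenvalue d j1 or is zero. *)
Lemma second_eigenvalue_eq (g : 'cV[R]_n) : \sum_j g j 0 = 0 ->
  (g^T *m (A *m g - d 0 j1 *: g)) 0 0 = 0 -> A *m g = d 0 j1 *: g.
Proof.
move=> g0 /(congr1 toC); rewrite gap_form => /psumr_eq0P h.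
apply/eqP; rewrite -subr_eq0; apply/eqP; apply: (@map_mx_inj _ _ toC).
rewrite shifted_coord map_mx0.
rewrite (_ : \col_i _ = 0) ?mulmx0 //; apply/colP=> i; rewrite [LHS]mxE [RHS]mxE.
have := h (fun k _ => spectral_gap_term k g0) i isT.
by move/eqP; rewrite mulf_eq0 conjC_eq0 => /orP[/eqP->|/eqP//]; rewrite mulr0.
Qed.

(** If the constant vector has no component along the j1-th eigenvector, that
    eigenvector has sum zero.  Otherwise d j0 = d j1 = 0, and some combination
    of the two eigenvectors is orthogonal to the constants. *)
Lemma complex_second_eigenvector : exists f : 'cV[R[i]]_n,
  [/\ f != 0, \sum_j f j 0 = 0 & map_mx toC A *m f = toC (d 0 j1) *: f].
Proof.
suff [c [c0 zc dc]] : exists c : 'cV[R[i]]_n, [/\ c != 0,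
    \sum_i (z i 0)^* * c i 0 = 0 & forall i, toC (d 0 i) * c i 0 = toC (d 0 j1) * c i 0].
  exists (P^t* *m c); split.
  - apply: contraNneq c0 => e.
    by rewrite -[c]mul1mx -PPt -mulmxA e mulmx0.
  - have -> : \sum_j (P^t* *m c) j 0 =
      ((map_mx toC (const_mx 1 : 'cV[R]_n))^T *m (P^t* *m c)) 0 0.
      by rewrite [RHS]mxE; apply: eq_bigr => k _; rewrite !mxE rmorph1 mul1r.
    rewrite mulmxA.
    have -> : (map_mx toC (const_mx 1 : 'cV[R]_n))^T *m P^t* = z^t*.
      rewrite /z /coord trmx_mul map_mxM; congr (_ *m _).
      by apply/rowP=> i; rewrite !mxE; exact/esym/conjc_real.
    by rewrite mxE -[RHS]zc; apply: eq_bigr => i _; rewrite !mxE.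
  - rewrite defA -!mulmxA [P *m _]mulmxA PPt mul1mx scalemxAr; congr (_ *m _).
    by apply/colP=> i; rewrite mul_diag_mx !mxE dc.
have [zj1|zj1] := eqVneq (z j1 0) 0.
  exists (delta_mx j1 0); split.
  - apply/negP=> /eqP/colP/(_ j1); rewrite !mxE !eqxx /= => /eqP.
    by rewrite oner_eq0.
  - rewrite (bigD1 j1) //= big1 => [|k kj]; rewrite ?zj1 ?conjC0 ?mul0r ?addr0 //.
    by rewrite [X in _ * X]mxE (negPf kj) mulr0.
  - by move=> k; rewrite mxE; have [->|] := eqVneq k j1; rewrite ?mulr0.
have dj10 : d 0 j1 = 0 by apply/eqP; apply: contraNT zj1 => /dz ->.
have dj00 : d 0 j0 = 0.
  by apply/eqP; rewrite eq_le spectral_value_ge0 -dj10 dj01.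
pose c : 'cV[R[i]]_n := (z j1 0)^* *: delta_mx j0 0 - (z j0 0)^* *: delta_mx j1 0.
have combE k : c k 0 = (z j1 0)^* * (k == j0)%:R - (z j0 0)^* * (k == j1)%:R.
  by rewrite !mxE !andbT.
exists c; split.
- apply/negP=> /eqP/colP/(_ j0); rewrite combE [RHS]mxE.
  rewrite !eqxx (negPf j01) /= mulr0 subr0 mulr1.
  by move/eqP; rewrite conjC_eq0 (negPf zj1).
- rewrite (bigD1 j0) //= (bigD1 j1) 1?eq_sym //= big1 => [|k /andP[k0 k1]].
    rewrite !combE !eqxx (negPf j01) eq_sym (negPf j01) /=.
    by rewrite !mulr0 !mulr1 subr0 sub0r addr0 mulrN mulrC subrr.
  by rewrite combE (negPf k0) (negPf k1) !mulr0 subrr mulr0.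
- move=> k; rewrite combE dj10.
  have [->|k0] := eqVneq k j0; first by rewrite dj00.
  have [->|k1] := eqVneq k j1; first by rewrite dj10.
  by rewrite !mulr0 subrr !mulr0.
Qed.

(** Since A and the eigenvalue are real, the real and imaginary parts of a
    complex eigenvector are eigenvectors or zero. *)
Lemma second_eigenvector : exists g : 'cV[R]_n,
  [/\ g != 0, \sum_j g j 0 = 0 & A *m g = d 0 j1 *: g].
Proof.
have [f [f0 fs Af]] := complex_second_eigenvector.
have part (phi : R[i] -> R) : {morph phi : x y / x + y} ->
    (forall x y, phi (toC x * y) = x * phi y) -> map_mx phi f != 0 ->
    exists g : 'cV[R]_n, [/\ g != 0, \sum_j g j 0 = 0 & A *m g = d 0 j1 *: g].
  move=> phiD phiZ phi0.
  have p0 : phi 0 = 0 by have := phiZ 0 0; rewrite rmorph0 !mul0r.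
  exists (map_mx phi f); split => //.
    under eq_bigr => j _ do rewrite mxE.
    by rewrite -(big_morph phi phiD p0) fs.
  apply/colP=> i; move/colP/(_ i)/(congr1 phi): Af; rewrite !mxE phiZ => <-.
  rewrite (big_morph phi phiD p0); apply: eq_bigr => j _.
  by rewrite !mxE phiZ.
have [fr|] := eqVneq (map_mx (@complex.Re R) f) 0; last first.
  by apply: part; [case=> ? ? [] | move=> x [a b] /=; rewrite mul0r subr0].
apply: (part (@complex.Im R)); [by case=> ? ? [] | move=> x [a b] /=; by rewrite mul0r addr0 | ].
apply: contraNneq f0 => fi; apply/eqP/colP=> i.
move/colP/(_ i): fr; move/colP/(_ i): fi; rewrite !mxE.
by case: (f i 0) => a b /= -> ->.
Qed.

End SecondEigenvalue.
End Spectral.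

(** * Variational description of the algebraic connectivity *)

Section GraphLaplacian.
Local Open Scope ring_scope.
Variable R : realType.

(** Every edge is counted in both directions, so this is twice the quadratic
    form of the Laplacian. *)
Definition dirichlet (T : finType) (e : rel T) (f : T -> R) : R :=
  \sum_x \sum_y (e x y)%:R * (f x - f y) ^+ 2.

Definition graph_laplacian (T : finType) (e : rel T) (f : T -> R) (x : T) : R :=
  \sum_y (e x y)%:R * (f x - f y).

Lemma dirichletE (T : finType) (e : rel T) (f : T -> R) : symmetric e ->
  dirichlet e f = (\sum_x f x * graph_laplacian e f x) *+ 2.
Proof.
move=> esym; rewrite /dirichlet /graph_laplacian.
have -> : \sum_x \sum_y (e x y)%:R * (f x - f y) ^+ 2 =
    \sum_x \sum_y (e x y)%:R * (f x * (f x - f y)) +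
    \sum_x \sum_y (e x y)%:R * (f y * (f y - f x)).
  rewrite -big_split; apply: eq_bigr => x _; rewrite -big_split.
  by apply: eq_bigr => y _ /=; rewrite -mulrDr; congr (_ * _); ring.
rewrite [X in _ + X]exchange_big /= mulr2n; congr (_ + _); apply: eq_bigr => x _;
  by rewrite mulr_sumr; apply: eq_bigr => y _; rewrite ?(esym y x) mulrCA.
Qed.

Section OneGraph.
Variable G : sgraph.
Let L := laplacian_mx R G.

Definition graph_col (f : G -> R) : 'cV[R]_#|G| := \col_i f (enum_val i).

Lemma sum_graph_col (f : G -> R) : \sum_j graph_col f j 0 = \sum_x f x.
Proof.
rewrite (reindex (@enum_val G predT)) /=; last first.
  exact/onW_bij/enum_val_bij.
by apply: eq_bigr => i _; rewrite mxE.
Qed.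

Lemma laplacian_mxE (f : G -> R) :
  L *m graph_col f = graph_col (graph_laplacian (@adj G) f).
Proof.

apply/colP=> i; rewrite /L /laplacian_mx mulmxBl mul_diag_mx !mxE /graph_laplacian.
under [RHS]eq_bigr => y _ do rewrite mulrBr.
rewrite sumrB -mulr_suml -natr_sum; congr (_%:R * _ - _).
  by rewrite -sum1_card [LHS]big_mkcond /=; apply: eq_bigr => y _; rewrite inE; case: adj.
rewrite [RHS](reindex (@enum_val G predT)) /=; last exact/onW_bij/enum_val_bij.
by apply: eq_bigr => j _; rewrite !mxE.
Qed.

Lemma graph_col_dot (f : G -> R) (h : G -> R) :
  ((graph_col f)^T *m graph_col h) 0 0 = \sum_x f x * h x.
Proof.
rewrite mxE [RHS](reindex (@enum_val G predT)) /=; last exact/onW_bij/enum_val_bij.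
by apply: eq_bigr => j _; rewrite !mxE.
Qed.

Lemma graph_colK (g : 'cV[R]_#|G|) : graph_col (fun x => g (enum_rank x) 0) = g.
Proof. by apply/colP=> i; rewrite mxE enum_valK. Qed.

Let alpha := algebraic_connectivity R G.

(** What the rest of the proof needs to know about the algebraic connectivity:
    it is attained by an eigenvector of sum zero, it bounds the Rayleigh
    quotients of vectors of sum zero from below, and only eigenvectors reach
    the bound. *)
Lemma algebraic_connectivity_spectrum : (1 < #|G|)%N ->
  [/\ exists f : G -> R, [/\ exists x, f x != 0, \sum_x f x = 0 &
        forall x, graph_laplacian (@adj G) f x = alpha * f x],
      forall f : G -> R, \sum_x f x = 0 ->
        alpha * (\sum_x f x ^+ 2) *+ 2 <= dirichlet (@adj G) f
    & forall f : G -> R, \sum_x f x = 0 ->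
        dirichlet (@adj G) f = alpha * (\sum_x f x ^+ 2) *+ 2 ->
        forall x, graph_laplacian (@adj G) f x = alpha * f x].
Proof.
move=> n1.
have Lsym : L^T = L.
  apply/matrixP=> i j; rewrite !mxE adj_sym; congr (_ - _).
  by rewrite eq_sym; have [->|] := eqVneq i j.
have [P [d Pu defL]] := symmetric_spectral Lsym.
have psd (g : 'cV[R]_#|G|) : 0 <= (g^T *m L *m g) 0 0.
  rewrite -[g]graph_colK -mulmxA laplacian_mxE graph_col_dot.
  set f := fun x : G => _.
  rewrite -(@pmulrn_lge0 _ _ 2) // -dirichletE; last exact: adj_sym.
  apply: sumr_ge0 => x _; apply: sumr_ge0 => y _.
  by rewrite mulr_ge0 ?ler0n ?sqr_ge0.
have L1 : L *m const_mx 1 = 0 :> 'cV[R]_#|G|.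
  rewrite -[const_mx 1]graph_colK laplacian_mxE; apply/colP=> i; rewrite !mxE.
  by apply: big1 => y _; rewrite !mxE subrr mulr0.
have [j0 [j1 [j01 dj1E dj01 dj1]]] := sort_second_smallest (fun i => d 0 i) n1.
have aE : alpha = d 0 j1.
  rewrite dj1E /alpha /algebraic_connectivity /laplacian_eigenvalues.
  congr (_`__); apply/perm_sortP.
  - by move=> x y; exact: le_total.
  - by move=> x y z /= h1 h2; exact: le_trans h2 h1.
  - by move=> x y /= h; apply/le_anti; rewrite andbC.
  rewrite (similar_diag_char_poly Pu defL).
  have -> : \prod_i ('X - (d 0 i)%:P) =
      \prod_(x <- [seq d 0 i | i <- enum 'I_#|G|]) ('X - x%:P).
    by rewrite big_map big_enum.
  exact: real_roots_perm.
have dj1' i : i != j0 -> d 0 j1 <= d 0 i by exact: dj1.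
have formE (f : G -> R) :
    ((graph_col f)^T *m (L *m graph_col f - alpha *: graph_col f)) 0 0 *+ 2 =
    dirichlet (@adj G) f - alpha * (\sum_x f x ^+ 2) *+ 2.
  rewrite dirichletE; last exact: adj_sym.
  rewrite laplacian_mxE -mulrnBl; congr (_ *+ 2).
  rewrite mulmxBr -scalemxAr mxE graph_col_dot; congr (_ + _).
  by rewrite mxE mxE graph_col_dot.
split.
- have [g [g0 gs Lg]] := second_eigenvector Pu defL psd L1 j01 dj01.
  exists (fun x => g (enum_rank x) 0); split.
  + have [i gi] : exists i, g i 0 != 0.
      apply/existsP; apply: contraNT g0; rewrite negb_exists => /forallP h; apply/eqP/colP=> i.
      by have := h i; rewrite negbK => /eqP ->; rewrite mxE.
    by exists (enum_val i); rewrite enum_valK.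
  + by rewrite -sum_graph_col graph_colK.
  + move=> x; rewrite -[g]graph_colK laplacian_mxE -aE in Lg.
    by move/colP/(_ (enum_rank x)): Lg; rewrite !mxE enum_rankK.
- move=> f fs; rewrite -subr_ge0 -formE pmulrn_lge0 // aE.
  by apply: (second_eigenvalue_le Pu defL psd L1 dj01 dj1'); rewrite sum_graph_col.
- move=> f fs /eqP; rewrite -subr_eq0 -formE mulrn_eq0 /= => /eqP h x.
  have := second_eigenvalue_eq Pu defL psd L1 dj01 dj1' (g := graph_col f).
  rewrite -aE sum_graph_col => /(_ fs h); rewrite laplacian_mxE.
  by move/colP/(_ (enum_rank x)); rewrite !mxE enum_rankK.
Qed.
End OneGraph.
End GraphLaplacian.

(** * Edges across the gaps of a linear order *)

Section Rearrangement.

(** S colours the vertices; removing x never separates the two colours, if both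
    occur away from x. *)
Definition no_cut_vertex (T : finType) (e : rel T) : Prop :=
  forall (x : T) (S : pred T) y0 z0,
    S y0 -> ~~ S z0 -> y0 != x -> z0 != x ->
    exists y z, [/\ S y, ~~ S z, y != x, z != x & e y z].

Definition deg (T : finType) (e : rel T) (x : T) : nat := \sum_y e x y.

(** A first edge across S is found away from some third vertex x; a second one
    is found away from the end of the first edge that lies on the side of x,
    a removal which leaves x on that side. *)
Lemma two_cut_edges (T : finType) (e : rel T) (S : pred T) y0 z0 :
  no_cut_vertex e -> 2 < #|T| -> S y0 -> ~~ S z0 ->
  exists y z y' z', [/\ S y, ~~ S z & e y z] /\
    [/\ S y', ~~ S z', e y' z' & (y, z) != (y', z')].
Proof.
move=> ncv T3 Sy0 Sz0.
have /existsP[x /andP[xy xz]] : [exists x, (x != y0) && (x != z0)].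
  rewrite -negb_forall_in; apply: contraTN T3 => /forallP h; rewrite -leqNgt.
  apply: leq_trans (_ : #|[set y0; z0]| <= 2); last by rewrite cards2; case: eqP.
  apply/subset_leq_card/subsetP=> t _; have := h t; rewrite !inE.
  by case: (t == y0).
have [y [z [Sy Sz yx zx yz]]] : exists y z, [/\ S y, ~~ S z, y != x, z != x & e y z].
  by apply: (ncv x S y0 z0); rewrite // eq_sym.
exists y, z; have [Sx|Sx] := boolP (S x).
  have [||y' [z' [Sy' Sz' yy _ yz']]] := ncv y S x z0 Sx Sz0; rewrite 1?eq_sym //.
    by apply: contraNneq Sz0 => <-.
  by exists y', z'; rewrite xpair_eqE eq_sym (negPf yy).
have [||y' [z' [Sy' Sz' _ zz yz']]] := ncv z S y0 x Sy0 Sx; rewrite 1?eq_sym //.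
  by apply: contraNneq Sz => ->.
by exists y', z'; rewrite xpair_eqE andbC eq_sym (negPf zz).
Qed.

Lemma no_cut_vertex_deg_ge2 (T : finType) (e : rel T) (x : T) :
  no_cut_vertex e -> 2 < #|T| -> 2 <= deg e x.
Proof.
move=> ncv T3.
have /existsP[w wx] : [exists w, w != x].
  rewrite -negb_forall; apply: contraTN T3 => /forallP h; rewrite -leqNgt.
  apply: leq_trans (_ : #|[set x]| <= 2); last by rewrite cards1.
  by apply/subset_leq_card/subsetP=> t _; rewrite inE; apply: h.
have [y [z [y' [z' [[/eqP-> zx yz] [/eqP-> zx' yz' ne]]]]]] :=
  two_cut_edges (S := pred1 x) ncv T3 (eqxx x) wx.
rewrite /deg (bigD1 z) //= (bigD1 z') /=.
  by rewrite yz yz'.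
by rewrite xpair_eqE eqxx eq_sym in ne.
Qed.

Section Gaps.
Variables (n : nat).
Implicit Types (e : rel 'I_n) (i j k l : nat).

(** The k-th gap lies between the vertices k - 1 and k. *)
Definition separates k i j : bool := (k <= i) (+) (k <= j).

(** Ordered pairs are counted, so an edge contributes 2. *)
Definition cut2 e k l : nat :=
  \sum_(i < n) \sum_(j < n) [&& e i j, separates k i j & separates l i j].

Lemma cut2_card e k l : cut2 e k l =
  #|[set p : 'I_n * 'I_n | [&& e p.1 p.2, separates k p.1 p.2 & separates l p.1 p.2]]|.
Proof.
rewrite /cut2 pair_bigA -sum1dep_card [RHS]big_mkcond /=.
by apply: eq_bigr => p _; case: ifP.
Qed.

Lemma cut2_le e k l (s : seq (nat * nat)) :
  (forall i j : 'I_n, e i j -> separates k i j -> separates l i j ->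
     (val i, val j) \in s) -> cut2 e k l <= size s.
Proof.
move=> h; rewrite cut2_card cardE.
set A := enum _; rewrite -(size_map (fun p : 'I_n * 'I_n => (val p.1, val p.2))).
apply: uniq_leq_size.
  rewrite map_inj_uniq ?enum_uniq // => -[a b] [c d] /= [] ac bd.
  by congr (_, _); apply: val_inj.
move=> _ /mapP[p pA ->]; move: pA; rewrite mem_enum inE => /and3P[? ? ?]; exact: h.
Qed.

Lemma cut2_ge e k l (s : seq ('I_n * 'I_n)) : uniq s ->
  (forall p, p \in s -> [&& e p.1 p.2, separates k p.1 p.2 & separates l p.1 p.2]) ->
  size s <= cut2 e k l.
Proof.
move=> us h; rewrite cut2_card -(card_uniqP us); apply/subset_leq_card/subsetP=> p ps.
by rewrite inE h.
Qed.

Lemma cut2C e k l : cut2 e k l = cut2 e l k.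
Proof.
by apply: eq_bigr => i _; apply: eq_bigr => j _; rewrite [separates l _ _ && _]andbC.
Qed.

Lemma cut2_out e k l : (k == 0) || (n <= k) -> cut2 e k l = 0.
Proof.
move=> h; apply: big1 => i _; apply: big1 => j _; rewrite /separates.
have ii := ltn_ord i; have jj := ltn_ord j.
have -> : (k <= i) (+) (k <= j) = false by apply/negbTE; lia.
by rewrite andbF.
Qed.

(** The cycle 0 - 2 - 4 - ... - 5 - 3 - 1 - 0: vertices at distance two are
    adjacent, and the cycle is closed by the edges {0, 1} and {n - 2, n - 1}. *)
Definition zigzag : rel 'I_n :=
  fun (i j : 'I_n) => [|| j == i + 2 :> nat, i == j + 2 :> nat, i + j == 1 | i + j + 3 == n + n].

(** The value of [cut2] on the zigzag cycle: two edges cross a gap, one edge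
    jumps over the vertex between two consecutive gaps, none goes further. *)
Definition zigzag_cut k l : nat :=
  if k == l then 4 else if (l == k.+1) || (k == l.+1) then 2 else 0.

Lemma cut2_zigzag k l : 0 < k < n -> 0 < l < n -> cut2 zigzag k l <= zigzag_cut k l.
Proof.
wlog kl : k l / k <= l.
  move=> h kn ln; have [|/ltnW] := leqP k l; first by move=> kl; exact: h.
  move=> lk; rewrite cut2C (leq_trans (h _ _ lk ln kn)) //.
  by rewrite /zigzag_cut eq_sym orbC.
move=> kn ln; rewrite /zigzag_cut /zigzag.
case: eqP => [<-{l kl ln}|kl'].
  (* The edge over k - 1 and the edge over k, clamped to the range 0..n-1. *)
  apply: (cut2_le (s := [:: (k.-2, k); (k.-1, minn k.+1 n.-1);
                           (k, k.-2); (minn k.+1 n.-1, k.-1)])) => i j.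
  have ii := ltn_ord i; have jj := ltn_ord j.
  by rewrite /separates !inE !xpair_eqE /=; lia.
case: ifP => [kl1|kl2].
  apply: (cut2_le (s := [:: (k.-1, k.+1); (k.+1, k.-1)])) => i j.
  have ii := ltn_ord i; have jj := ltn_ord j.
  by rewrite /separates !inE !xpair_eqE /=; lia.
apply: (cut2_le (s := [::])) => i j.
have ii := ltn_ord i; have jj := ltn_ord j.
by rewrite /separates in_nil; lia.
Qed.

(** Two edges cross a gap by [two_cut_edges].  For consecutive gaps k and k + 1,
    removing the vertex k between them leaves an edge that crosses both. *)
Lemma zigzag_cut_le e k l : 2 < n -> symmetric e -> no_cut_vertex e ->
  0 < k < n -> 0 < l < n -> zigzag_cut k l <= cut2 e k l.
Proof.
move=> n3 esym ncv; wlog kl : k l / k <= l.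
  move=> h kn ln; have [|/ltnW] := leqP k l; first by move=> kl; exact: h.
  move=> lk; rewrite cut2C (leq_trans _ (h _ _ lk ln kn)) //.
  by rewrite /zigzag_cut eq_sym orbC.
move=> kn ln; rewrite /zigzag_cut.
have n0 : 0 < n by lia.
have nn : n.-1 < n by lia.
case: eqP => [<-{l kl ln}|kl'].
  have [|||y [z [y' [z' [[Sy Sz yz] [Sy' Sz' yz' ne]]]]]] :=
    @two_cut_edges _ e (fun i : 'I_n => k <= i) (Ordinal nn) (Ordinal n0) ncv.
  - by rewrite card_ord.
  - by rewrite /=; lia.
  - rewrite /= -ltnNge; lia.
  have [zy zy'] : e z y /\ e z' y' by rewrite !(esym z) !(esym z').
  apply: (@cut2_ge e k k [:: (y, z); (y', z'); (z, y); (z', y')]).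
    move: ne; rewrite /= !inE !xpair_eqE -!val_eqE /=; lia.
  move=> p; rewrite !inE => /or4P[] /eqP -> /=; rewrite /separates ?yz ?yz' ?zy ?zy' /=; lia.
case: ifP => [kl1|//].
have kn' : k < n by lia.
have [||||y [z [Sy Sz yk zk yz]]] :=
    ncv (Ordinal kn') (fun i : 'I_n => k < i) (Ordinal nn) (Ordinal n0);
  rewrite -?val_eqE /=; try lia.
rewrite -val_eqE /= in yk; rewrite -val_eqE /= in zk.
have zy : e z y by rewrite esym.
apply: (@cut2_ge e k l [:: (y, z); (z, y)]).
  by rewrite /= !inE !xpair_eqE -!val_eqE /=; lia.
move=> p; rewrite !inE => /orP[] /eqP -> /=; rewrite /separates ?yz ?zy /=; lia.
Qed.

(** An edge that crosses exactly one of the gaps k and l is an edge that leaves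
    the interval [k, l). *)
Lemma cut2_range e k l : k <= l ->
  cut2 e k k + cut2 e l l = 2 * cut2 e k l +
  \sum_(i < n) \sum_(j < n) (e i j && ((k <= i < l) (+) (k <= j < l))).
Proof.
move=> kl; rewrite /cut2 big_distrr -!big_split; apply: eq_bigr => i _ /=.
rewrite big_distrr -!big_split; apply: eq_bigr => j _ /=; rewrite /separates.
case: (e i j) => //=; lia.
Qed.

End Gaps.

Lemma boundary_sum (T : finType) (e : rel T) (S : pred T) : symmetric e ->
  \sum_x \sum_y (e x y && (S x (+) S y)) = 2 * \sum_(x | S x) \sum_y (e x y && ~~ S y).
Proof.
move=> esym.
have -> : \sum_x \sum_y (e x y && (S x (+) S y)) =
   \sum_x \sum_y (e x y && S x && ~~ S y) + \sum_x \sum_y (e x y && S y && ~~ S x).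
  rewrite -big_split; apply: eq_bigr => x _; rewrite -big_split.
  by apply: eq_bigr => y _ /=; case: (e x y) (S x) (S y) => [] [] [].
rewrite [X in _ + X]exchange_big /= mul2n -addnn [in RHS]big_mkcond /=; congr (_ + _);
  apply: eq_bigr => x _; case: ifP => Sx; try (by apply: big1 => y _; rewrite andbF);
  by apply: eq_bigr => y _; rewrite ?(esym y x) andbT.
Qed.

Lemma boundary1 (T : finType) (e : rel T) (u : T) : symmetric e -> irreflexive e ->
  \sum_x \sum_y (e x y && ((x == u) (+) (y == u))) = 2 * deg e u.
Proof.
move=> esym eirr; rewrite (boundary_sum (pred1 u) esym) big_pred1_eq; congr (_ * _).
by apply: eq_bigr => y _ /=; case: eqP => [->|]; rewrite ?eirr ?andbT.
Qed.

Lemma boundary2 (T : finType) (e : rel T) (u v : T) : symmetric e -> irreflexive e ->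
  u != v ->
  \sum_x \sum_y (e x y && ((x \in [:: u; v]) (+) (y \in [:: u; v]))) + 4 * e u v
    = 2 * (deg e u + deg e v).
Proof.
move=> esym eirr uv; rewrite (boundary_sum (mem [:: u; v]) esym).
rewrite -big_uniq /=; last by rewrite inE uv.
rewrite !big_cons big_nil addn0.
have part a b : a != b -> (forall y, (y \in [:: u; v]) = (y == a) || (y == b)) ->
    deg e a = \sum_y (e a y && (y \notin [:: u; v])) + e a b.
  move=> ab h; rewrite /deg (bigD1 b) //= [in RHS](bigD1 b) //= h eqxx orbT andbF.
  rewrite add0n addnC; congr (_ + _); apply: eq_bigr => y yb; rewrite h (negPf yb) orbF.
  by case: eqP => [->|_]; rewrite ?eirr ?andbT.
rewrite (part u v) // => [|y]; last by rewrite !inE.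
rewrite (part v u) 1?eq_sym // => [|y]; last by rewrite !inE orbC.
by rewrite (esym v u) addnACA [in RHS]mulnDr addnn -mul2n mulnA.
Qed.

End Rearrangement.

(** * The Dirichlet form of a sorted sequence *)

Section Layers.
Local Open Scope ring_scope.
Variables (R : realType) (n : nat) (h : nat -> R).
Let d k := h k - h k.-1.

(** The term k = 0 vanishes because the gap h 0 - h 0.-1 is zero; this lets
    the sum run over all of 'I_n. *)
Lemma telescope_gaps i : (i < n)%N -> h i = h 0%N + \sum_(k < n) d k * (k <= i)%N%:R.
Proof.
move=> i_n; under eq_bigr => k _ do rewrite mulr_natr mulrb.
rewrite -big_mkcond /= -(big_ord_widen n (fun k => d k) (n1 := i.+1)) //.
rewrite big_ord_recl /d /= subrr add0r.
rewrite -(big_mkord xpredT (fun k => h k.+1 - h k)) telescope_sumr //.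
by rewrite addrC subrK.
Qed.

(** In (h i - h j)^2 the product of the gaps k and l appears with coefficient 1
    if both gaps separate i from j, and 0 otherwise, whatever the order of i
    and j. *)
Lemma dirichlet_gaps (e : rel 'I_n) :
  dirichlet e (fun i => h i) = \sum_(k < n) \sum_(l < n) d k * d l * (cut2 e k l)%:R.
Proof.
have sq (i j : 'I_n) : (h i - h j) ^+ 2 = \sum_(k < n) \sum_(l < n)
    d k * d l * (separates k i j && separates l i j)%:R.
  have -> : h i - h j = \sum_(k < n) d k * ((k <= i)%N%:R - (k <= j)%N%:R).
    rewrite (telescope_gaps (ltn_ord i)) (telescope_gaps (ltn_ord j)).
    rewrite [h 0%N + _]addrC addrKA -sumrB.
    by apply: eq_bigr => k _; rewrite mulrBr.
  rewrite expr2 big_distrlr /=; apply: eq_bigr => k _; apply: eq_bigr => l _.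
  rewrite mulrACA; congr (_ * _); rewrite /separates.
  case: (leqP k i) (leqP k j) (leqP l i) (leqP l j) => [h1|h1] [h2|h2] [h3|h3] [h4|h4];
    rewrite /= ?subrr ?mul0r ?mulr0 ?subr0 ?sub0r ?mulrNN ?mulr1 //; lia.
rewrite /dirichlet /cut2.
under eq_bigr => i _ do (under eq_bigr => j _ do (rewrite sq mulr_sumr;
  under eq_bigr => k _ do rewrite mulr_sumr)).
transitivity (\sum_(p : 'I_n * 'I_n) \sum_(q : 'I_n * 'I_n)
  d q.1 * d q.2 * [&& e p.1 p.2, separates q.1 p.1 p.2 & separates q.2 p.1 p.2]%:R).
  rewrite pair_bigA; apply: eq_bigr => p _; rewrite pair_bigA; apply: eq_bigr => q _ /=.
  by case: (e p.1 p.2); rewrite ?mul1r // mul0r mulr0.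
rewrite exchange_big /= [RHS]pair_bigA; apply: eq_bigr => q _ /=.
rewrite pair_bigA natr_sum mulr_sumr; by apply: eq_bigr => p _.
Qed.

Hypothesis h_mono : forall k, (k.+1 < n)%N -> h k <= h k.+1.

Let d_ge0 k : (k < n)%N -> 0 <= d k.
Proof. by case: k => [|k] kn; rewrite /d ?subrr // subr_ge0 h_mono. Qed.

Let d0 : d 0 = 0. Proof. exact: subrr. Qed.

Let zigzag_cut_diag k : zigzag_cut k k = 4%N.
Proof. by rewrite /zigzag_cut eqxx. Qed.

Let zigzag_cut_next k : zigzag_cut k k.+1 = 2%N.
Proof. by rewrite /zigzag_cut eqxx; case: eqP => // h1; lia. Qed.

Let zigzag_cut_far k : zigzag_cut k k.+2 = 0%N.
Proof. by rewrite /zigzag_cut; case: eqP => [|_]; [lia | case: ifP => //; lia]. Qed.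

Section Compare.
Variable e : rel 'I_n.
Hypotheses (n3 : (2 < n)%N) (e_sym : symmetric e) (e_ncv : no_cut_vertex e).

Let cut_term (k l : 'I_n) :
  0 <= d k * d l * (cut2 e k l)%:R - d k * d l * (cut2 (@zigzag n) k l)%:R.
Proof.
have [k0|k0] := posnP k; first by rewrite k0 d0 !mul0r subrr.
have [l0|l0] := posnP l; first by rewrite l0 d0 mulr0 !mul0r subrr.
rewrite -mulrBr !mulr_ge0 ?d_ge0 // subr_ge0 ler_nat.
apply: leq_trans (cut2_zigzag _ _) (zigzag_cut_le _ _ _ _ _) => //; by rewrite ?k0 ?l0 /=.
Qed.

(** The gap counts are compared term by term, which is legitimate since the
    gaps of a sorted sequence are nonnegative. *)
Lemma zigzag_dirichlet_le : dirichlet (@zigzag n) (fun i => h i) <= dirichlet e (fun i => h i).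
Proof.
rewrite -subr_ge0 !dirichlet_gaps -sumrB sumr_ge0 // => k _.
by rewrite -sumrB sumr_ge0 // => l _.
Qed.

Lemma zigzag_dirichlet_eq :
  dirichlet (@zigzag n) (fun i => h i) = dirichlet e (fun i => h i) ->
  forall k l, (0 < k < n)%N -> (0 < l < n)%N -> d k != 0 -> d l != 0 ->
    cut2 e k l = zigzag_cut k l.
Proof.
move=> /esym/eqP; rewrite -subr_eq0 !dirichlet_gaps -sumrB => /eqP.
under eq_bigr => k _ do rewrite -sumrB.
rewrite pair_bigA => /psumr_eq0P H k l kn ln dk dl.
have [k_n l_n] : (k < n)%N /\ (l < n)%N by lia.
have /(_ (Ordinal k_n, Ordinal l_n) isT) /= := H (fun p _ => cut_term p.1 p.2).
move/eqP; rewrite -mulrBr !mulf_eq0 (negPf dk) (negPf dl) /= subr_eq0 eqr_nat.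
move/eqP=> c; apply/eqP; rewrite eqn_leq zigzag_cut_le // andbT c.
exact: cut2_zigzag.
Qed.

(** Used when {k, k + 1} is a tie class: the gaps that bound it are nonzero or at an
    end of the order, so [cut2_range] counts the edges leaving it. *)
Lemma pair_degree k : (k.+1 < n)%N -> irreflexive e ->
  dirichlet (@zigzag n) (fun i => h i) = dirichlet e (fun i => h i) ->
  (k = 0%N \/ d k != 0) -> (k.+2 = n \/ d k.+2 != 0) ->
  forall u v : 'I_n, u = k :> nat -> v = k.+1 :> nat ->
  (deg e u + deg e v = (if (k == 0) || (k.+2 == n) then 2 else 4) + 2 * e u v)%N.
Proof.
move=> k1n eirr eqD gk gk2 u v uk vk.
have uv : u != v by rewrite -val_eqE /= uk vk; lia.
have cE := zigzag_dirichlet_eq eqD.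
have := @cut2_range n e k k.+2 (leqW (leqnSn k)).
have := boundary2 e_sym eirr uv.
have -> : (\sum_x \sum_y (e x y && ((x \in [:: u; v]) (+) (y \in [:: u; v]))) =
  \sum_(i < n) \sum_(j < n) (e i j && ((k <= i < k.+2) (+) (k <= j < k.+2))))%N.
  have E (x : 'I_n) : (x \in [:: u; v]) = (k <= x < k.+2)%N.
    by rewrite !inE -!val_eqE /= uk vk; lia.
  by apply: eq_bigr => x _; apply: eq_bigr => y _; rewrite !E.
have c0 : k = 0%N -> cut2 e k k = 0%N /\ cut2 e k k.+2 = 0%N.
  by move=> ->; split; apply: cut2_out.
have cn : k.+2 = n -> cut2 e k.+2 k.+2 = 0%N /\ cut2 e k k.+2 = 0%N.
  by move=> kn; rewrite (cut2C e k); split; apply: cut2_out; rewrite kn leqnn orbT.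
have ck : (0 < k)%N -> cut2 e k k = 4%N.
  by move=> k0; case: gk => [k0'|dk]; [lia | rewrite cE ?zigzag_cut_diag //; lia].
have ck2 : (k.+2 < n)%N -> cut2 e k.+2 k.+2 = 4%N.
  by move=> k0; case: gk2 => [k0'|dk]; [lia | rewrite cE ?zigzag_cut_diag //; lia].
have ckk2 : (0 < k)%N -> (k.+2 < n)%N -> cut2 e k k.+2 = 0%N.
  move=> k0 kn; case: gk gk2 => [ka|dk] [kb|dk2]; try lia.
  by rewrite cE ?zigzag_cut_far //; lia.
move: (deg e u) (deg e v) (e u v : nat) => du dv euv.
have [k0|k0] := posnP k.
  have [-> ->] := c0 k0; rewrite ck2; last by lia.
  by move=> E1 E2; rewrite k0 /=; lia.
have [k2n|k2n] := eqVneq k.+2 n.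
  by have [-> ->] := cn k2n; rewrite ck //= => E1 E2; lia.
by rewrite ck // ck2 ?ckk2 /=; lia.
Qed.

Lemma single_degree k : (k < n)%N -> irreflexive e ->
  dirichlet (@zigzag n) (fun i => h i) = dirichlet e (fun i => h i) ->
  (k = 0%N \/ d k != 0) -> (k.+1 = n \/ d k.+1 != 0) ->
  forall u : 'I_n, u = k :> nat -> deg e u = 2.
Proof.
move=> kn eirr eqD gk gk1 u uk.
have cE := zigzag_dirichlet_eq eqD.
have := @cut2_range n e k k.+1 (leqnSn k).
have := boundary1 u e_sym eirr.
have -> : (\sum_x \sum_y (e x y && ((x == u) (+) (y == u))) =
  \sum_(i < n) \sum_(j < n) (e i j && ((k <= i < k.+1) (+) (k <= j < k.+1))))%N.
  have E (x : 'I_n) : (x == u) = (k <= x < k.+1)%N.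
    by rewrite -!val_eqE /= uk; lia.
  by apply: eq_bigr => x _; apply: eq_bigr => y _; rewrite !E.
have ck : (0 < k)%N -> cut2 e k k = 4%N.
  by move=> k0; case: gk => [k0'|dk]; [lia | rewrite cE ?zigzag_cut_diag //; lia].
have ck1 : (k.+1 < n)%N -> cut2 e k.+1 k.+1 = 4%N.
  by move=> k0; case: gk1 => [k0'|dk]; [lia | rewrite cE ?zigzag_cut_diag //; lia].
have ckk1 : (0 < k)%N -> (k.+1 < n)%N -> cut2 e k k.+1 = 2%N.
  move=> k0 k1n; case: gk gk1 => [ka|dk] [kb|dk1]; try lia.
  by rewrite cE ?zigzag_cut_next //; lia.
have c0 : k = 0%N -> cut2 e k k = 0%N /\ cut2 e k k.+1 = 0%N.
  by move=> ->; split; apply: cut2_out.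
have cn : k.+1 = n -> cut2 e k.+1 k.+1 = 0%N /\ cut2 e k k.+1 = 0%N.
  by move=> k1n; rewrite (cut2C e k); split; apply: cut2_out; rewrite k1n leqnn orbT.
move: (\sum_(i < n) _)%N => s.
have [k0|k0] := posnP k.
  by have [-> ->] := c0 k0; rewrite ck1; lia.
have [k1n|k1n] := eqVneq k.+1 n.
  by have [-> ->] := cn k1n; rewrite ck //; lia.
by rewrite ck // ck1 ?ckk1; lia.
Qed.

(** If u shares its value with neither of the vertices next to it in the order,
    its degree is 2 by [single_degree].  So it shares its value with one of
    them, v, and with no third vertex by assumption; since
    deg v >= 2, the count of [pair_degree] forces u and v to be adjacent and
    deg v = 3. *)
Lemma degree3_neighbour : irreflexive e ->
  dirichlet (@zigzag n) (fun i => h i) = dirichlet e (fun i => h i) ->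
  (forall k, (k.+2 < n)%N -> h k != h k.+2) ->
  forall u, deg e u = 3 -> exists2 v, e u v & deg e v = 3.
Proof.
move=> eirr eqD notriple u u3.
have deg2 v : (2 <= deg e v)%N.
  by apply: no_cut_vertex_deg_ge2; rewrite ?card_ord.
have dd k : (k.+2 < n)%N -> d k.+1 = 0 -> d k.+2 != 0.
  move=> kn /eqP; rewrite /d /= subr_eq0 => /eqP ->.
  by rewrite subr_eq0 eq_sym notriple.
have un := ltn_ord u.
have pair k (kn : (k.+1 < n)%N) : d k.+1 = 0 -> forall x y : 'I_n, x = k :> nat -> y = k.+1 :> nat ->
    (deg e x + deg e y = (if (k == 0) || (k.+2 == n) then 2 else 4) + 2 * e x y)%N.
  move=> dk; apply: pair_degree => //.
    case: k dk kn => [|k] dk kn; [by left|right].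
    by apply/negP=> /eqP dk'; have := dd k kn dk'; rewrite dk eqxx.
  by have [|ne] := eqVneq k.+2 n; [left|right; apply: dd => //; lia].
have interior (v : 'I_n) (s : bool) : (deg e u + deg e v = (if s then 2 else 4) + 2 * e u v)%N ->
    exists2 v, e u v & deg e v = 3.
  move=> E; exists v; have := deg2 v; move: E; rewrite u3; case: s (e u v) => [] [] /=; lia.
have [/andP[u1n /eqP du1]|up] := boolP ((u.+1 < n)%N && (d u.+1 == 0)).
  exact: (interior (Ordinal u1n) _ (pair u u1n du1 u (Ordinal u1n) erefl erefl)).
have [/andP[u0 /eqP du]|down] := boolP ((0 < u)%N && (d u == 0)).
  have vn : (u.-1 < n)%N by lia.
  have v1n : (u.-1.+1 < n)%N by lia.
  have dv : d u.-1.+1 = 0 by rewrite prednK.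
  apply: (interior (Ordinal vn)); rewrite addnC e_sym.
  by apply: (pair u.-1 v1n dv) => //=; rewrite prednK.
suff u2 : deg e u = 2 by rewrite u2 in u3.
apply: (single_degree un eirr eqD _ _ erefl).
- have [|u0] := posnP u; [by left|right]; by move: down; rewrite u0.
- have [u1n|] := ltnP u.+1 n; [right|by left; lia]; by move: up; rewrite u1n.
Qed.
End Compare.
End Layers.

(** * Comparison with the cycle *)

Lemma isomorphic_sym (G H : sgraph) : isomorphic G H -> isomorphic H G.
Proof.
case=> f [g fK gK] fe; exists g; first by exists f.
by move=> x y; rewrite -fe !gK.
Qed.

Section ZigzagCycle.
Variable n : nat.

Lemma zigzag_sym : symmetric (@zigzag n).
Proof. by move=> i j; rewrite /zigzag (addnC i j) orbCA. Qed.

Lemma zigzag_irrefl : irreflexive (@zigzag n).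
Proof. by move=> i; rewrite /zigzag; lia. Qed.

Definition zigzag_graph : sgraph := SGraph zigzag_sym zigzag_irrefl.

Lemma zigzag_walk_subproof (i : 'I_n) : (if 2 * i < n then 2 * i else 2 * (n - i) - 1) < n.
Proof. by have := ltn_ord i; case: ifP; lia. Qed.

(** The vertices of the zigzag cycle in cyclic order: even ones upwards, then
    odd ones downwards. *)
Definition zigzag_walk (i : 'I_n) : 'I_n := Ordinal (zigzag_walk_subproof i).

Lemma cycle_zigzag : 2 < n -> isomorphic (cycle_graph n) zigzag_graph.
Proof.
move=> n3; exists zigzag_walk.
  apply: injF_bij => i j /(congr1 val) /= E; apply: val_inj; move: E.
  have := ltn_ord i; have := ltn_ord j.
  by case: ifP; case: ifP; rewrite /=; lia.
move=> i j; rewrite /= /cycle_rel /zigzag -!val_eqE /=.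
have ii := ltn_ord i; have jj := ltn_ord j.
have S (k : nat) : k < n -> k.+1 %% n = if k.+1 == n then 0 else k.+1.
  by move=> kn; case: eqP => [->|kn']; [rewrite modnn | rewrite modn_small //; lia].
rewrite !S //.
by do ![case: ifP] => *; lia.
Qed.
End ZigzagCycle.

Section Transfer.
Local Open Scope ring_scope.
Variable R : realType.

Lemma dirichlet_bij (S T : finType) (e : rel S) (e' : rel T) (g : S -> T) (f : T -> R) :
  bijective g -> {mono g : x y / e x y >-> e' x y} ->
  dirichlet e (f \o g) = dirichlet e' f.
Proof.
move=> gb ge; rewrite /dirichlet [RHS](reindex g) /=; last exact: onW_bij.
apply: eq_bigr => x _; rewrite [RHS](reindex g) /=; last exact: onW_bij.
by apply: eq_bigr => y _; rewrite ge.
Qed.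

Lemma sum_bij (S T : finType) (g : S -> T) (f : T -> R) :
  bijective g -> \sum_x f (g x) = \sum_y f y.
Proof. by move=> gb; rewrite [RHS](reindex g) //; exact: onW_bij. Qed.

Lemma sum_sqr_gt0 (T : finType) (f : T -> R) x : f x != 0 -> 0 < \sum_y f y ^+ 2.
Proof.
move=> fx; rewrite (bigD1 x) //= ltr_pwDl ?exprn_even_gt0 //.
by apply: sumr_ge0 => y _; exact: sqr_ge0.
Qed.

Lemma fiedler_dirichlet (G : sgraph) (f : G -> R) a :
  (forall x, graph_laplacian (@adj G) f x = a * f x) ->
  dirichlet (@adj G) f = a * (\sum_x f x ^+ 2) *+ 2.
Proof.
move=> fE; rewrite dirichletE; last exact: adj_sym.
by rewrite mulr_sumr; congr (_ *+ 2); apply: eq_bigr => x _; rewrite fE expr2 mulrCA.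
Qed.

Lemma isomorphic_connectivity_le (G H : sgraph) : (1 < #|G|)%N -> isomorphic G H ->
  algebraic_connectivity R G <= algebraic_connectivity R H.
Proof.
move=> n1 [g gb ge]; have cGH : #|G| = #|H| by exact: bij_eq_card gb.
have [_ Gle _] := algebraic_connectivity_spectrum R n1.
rewrite cGH in n1.
have [[f [[x fx] f0 fE]] _ _] := algebraic_connectivity_spectrum R n1.
have := Gle (f \o g); rewrite /= sum_bij // => /(_ f0).
rewrite (dirichlet_bij _ gb (e' := @adj H)) // (fiedler_dirichlet fE).
rewrite (sum_bij (fun y => f y ^+ 2) gb).
by rewrite ler_pMn2r // ler_pM2r // (sum_sqr_gt0 fx).
Qed.

Lemma isomorphic_connectivity (G H : sgraph) : (1 < #|G|)%N -> isomorphic G H ->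
  algebraic_connectivity R G = algebraic_connectivity R H.
Proof.
move=> n1 gh; apply/le_anti; rewrite isomorphic_connectivity_le //=.
apply: isomorphic_connectivity_le; last exact: isomorphic_sym.
by case: gh => g gb _; rewrite -(bij_eq_card gb).
Qed.

(** h is defined on all of nat so that gaps can be written with predecessors. *)
Lemma sorted_values (T : finType) (n : nat) (f : T -> R) : #|T| = n -> (0 < n)%N ->
  exists s : 'I_n -> T, exists h : nat -> R, [/\ bijective s,
    forall i, f (s i) = h i & forall k, (k.+1 < n)%N -> h k <= h k.+1].
Proof.
move=> Tn n0; have /card_gt0P[x0 _] : (0 < #|T|)%N by rewrite Tn.
set r := sort (relpre f <=%R) (enum T).
have sr : size r = n by rewrite size_sort -cardE.
have ur : uniq r by rewrite sort_uniq enum_uniq.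
exists (fun i => nth x0 r i), (fun k => f (nth x0 r k)); split => //.
  apply: inj_card_bij; last by rewrite card_ord Tn.
  by move=> i j /eqP; rewrite nth_uniq ?sr // => /eqP/val_inj.
move=> k kn.
have tot : total (relpre f <=%R) by move=> x y; exact: le_total.
have := sort_sorted tot (enum T); rewrite -/r => so.
by apply: (sortedP x0 so); rewrite sr.
Qed.
End Transfer.

Section ZigzagEigen.
Local Open Scope ring_scope.
Variables (R : realType) (n : nat) (h : nat -> R) (a : R).
Hypotheses (n3 : (2 < n)%N) (h_mono : forall k, (k.+1 < n)%N -> h k <= h k.+1).
Hypothesis h_eigen : forall i : 'I_n,
  graph_laplacian (@zigzag n) (fun j => h j) i = a * h i.

(** The neighbours i - 2 and i + 2 are clamped to the range 0..n-1, except at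
    the ends, where 0 has 1 as its second neighbour and n - 1 has n - 2. *)
Lemma zigzag_laplacian (i : 'I_n) :
  graph_laplacian (@zigzag n) (fun j => h j) i =
  (h i - h (if i == 0 :> nat then 1%N else i.-2)) +
  (h i - h (if i.+1 == n then n.-2 else minn i.+2 n.-1)).
Proof.
have ii := ltn_ord i.
have dn : ((if i == 0 :> nat then 1%N else i.-2) < n)%N by case: ifP; lia.
have up : ((if i.+1 == n then n.-2 else minn i.+2 n.-1) < n)%N by case: ifP; lia.
rewrite /graph_laplacian (bigD1 (Ordinal dn)) //= (bigD1 (Ordinal up)) /=; last first.
  by rewrite -val_eqE /=; do ![case: ifP]; lia.
rewrite big1 => [|j /andP[j1 j2]].
  have -> : zigzag i (Ordinal dn) by rewrite /zigzag /=; do ![case: ifP]; lia.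
  have -> : zigzag i (Ordinal up) by rewrite /zigzag /=; do ![case: ifP]; lia.
  by rewrite !mul1r addr0.
have -> : zigzag i j = false; last by rewrite mul0r.
have jj := ltn_ord j; move: j1 j2; rewrite -!val_eqE /= /zigzag.
by do ![case: ifP]; lia.
Qed.

Lemma sorted_le i j : (i <= j < n)%N -> h i <= h j.
Proof.
case/andP; elim: j => [|j IHj]; first by rewrite leqn0 => /eqP->.
rewrite leq_eqVlt => /predU1P[->//|ij] jn.
by rewrite (le_trans (IHj ij _)) ?h_mono // ltnW.
Qed.

(** One neighbour of p, and one of q, lies in the plateau and has the value h p,
    so the equations at p and q force the other neighbours to agree.  At an end
    of the order the clamped index and the true neighbour both belong to the
    plateau. *)
Lemma plateau_spreads p q : (p.+2 <= q < n)%N -> h p = h q -> h p.-2 = h (minn q.+2 n.-1).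
Proof.
move=> /andP[pq qn] hpq.
have pn : (p < n)%N by lia.
have mid k : (p <= k <= q)%N -> h k = h p.
  move=> /andP[pk kq]; apply/le_anti; rewrite [in X in X && _]hpq !sorted_le //; lia.
have dn : h p.-2 = h (if p == 0%N then 1%N else p.-2).
  by case: (p =P 0%N) => [p0|//]; rewrite (mid 1%N) ?p0 //; lia.
have up : h (minn q.+2 n.-1) = h (if q.+1 == n then n.-2 else minn q.+2 n.-1).
  case: (q.+1 =P n) => [qn'|//]; have -> : minn q.+2 n.-1 = q by lia.
  by rewrite (mid n.-2) //; lia.
have := h_eigen (Ordinal pn); have := h_eigen (Ordinal qn).
rewrite !zigzag_laplacian /= -up -dn -hpq.
have -> : (q == 0%N) = false by lia.
have -> : (p.+1 == n) = false by lia.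
have -> : h q.-2 = h p by apply: mid; lia.
have -> : h (minn p.+2 n.-1) = h p by apply: mid; lia.
by lra.
Qed.

(** A plateau of length three would spread until h is constant, that is zero
    because its sum is zero. *)
Lemma sorted_eigen_no_plateau k : (k.+2 < n)%N -> \sum_(i < n) h i = 0 ->
  (exists i : 'I_n, h i != 0) -> h k != h k.+2.
Proof.
move=> kn h0 [i hi]; apply: contraNneq hi => hk.
suff cst : h 0%N = h n.-1.
  have E (j : 'I_n) : h j = h 0%N.
    have jj := ltn_ord j.
    by apply/le_anti; rewrite [in X in X && _]cst !sorted_le //; lia.
  move: h0; under eq_bigr => j _ do rewrite E.
  rewrite sumr_const card_ord E => /eqP; rewrite mulrn_eq0 => /orP[|//]; lia.
suff H m p q : (p + (n.-1 - q) <= m)%N -> (p.+2 <= q < n)%N -> h p = h q -> h 0%N = h n.-1.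
  by apply: (H _ k k.+2 (leqnn _)) => //; rewrite leqnn.
elim: m p q => [|m IHm] p q pq pqn hpq.
  by move: hpq; have [-> ->] : p = 0%N /\ q = n.-1 by lia.
have [/andP[/eqP p0 /eqP qn]|ne] := boolP ((p == 0%N) && (q == n.-1)).
  by move: hpq; rewrite p0 qn.
apply: (IHm p.-2 (minn q.+2 n.-1)); try lia.
exact: plateau_spreads.
Qed.
End ZigzagEigen.

Lemma no_cut_vertex_bij (S T : finType) (e : rel S) (e' : rel T) (g : S -> T) :
  bijective g -> {mono g : x y / e x y >-> e' x y} ->
  no_cut_vertex e' -> no_cut_vertex e.
Proof.
case=> t gK tK ge ncv y A a b Aa Ab ay by_.
have [c [d [Ac Ad cy dy cd]]] : exists c d,
    [/\ A (t c), ~~ A (t d), c != g y, d != g y & e' c d].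
  by apply: (ncv (g y) (A \o t) (g a) (g b)); rewrite /= ?gK // (inj_eq (can_inj gK)).
exists (t c), (t d); split=> //; last by rewrite -ge !tK.
  by apply: contraNneq cy => <-; rewrite tK.
by apply: contraNneq dy => <-; rewrite tK.
Qed.

Section Main.
Local Open Scope ring_scope.
Variable R : realType.

(** Compare the eigenvector of G, sorted along the zigzag cycle, with the
    variational bound on C_n.  Equality makes the whole chain of inequalities
    an equality, so [degree3_neighbour] applies. *)
Lemma connectivity_vs_cycle (n : nat) (G : sgraph) : #|G| = n -> (2 < n)%N ->
  no_cut_vertex (@adj G) ->
  algebraic_connectivity R (cycle_graph n) <= algebraic_connectivity R G /\
  (algebraic_connectivity R G = algebraic_connectivity R (cycle_graph n) ->
   forall u : G, deg (@adj G) u = 3 -> exists2 v, adj u v & deg (@adj G) v = 3).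
Proof.
move=> Gn n3 ncv; have n1 : (1 < n)%N by exact: ltnW.
have cycleE : algebraic_connectivity R (cycle_graph n) =
    algebraic_connectivity R (zigzag_graph n).
  by apply: isomorphic_connectivity; [rewrite card_ord | exact: cycle_zigzag].
have G1 : (1 < #|G|)%N by rewrite Gn.
have [[f [[x fx] f0 fE]] _ _] := algebraic_connectivity_spectrum R G1.
have [s [h [sb sE hmono]]] := sorted_values f Gn (ltnW n1).
pose e : rel 'I_n := fun i j => adj (s i) (s j).
have esym : symmetric e by move=> i j; exact: adj_sym.
have eirr : irreflexive e by move=> i; exact: adj_irrefl.
have se : {mono s : x y / e x y >-> adj x y} by [].
have encv : no_cut_vertex e by exact: no_cut_vertex_bij sb se ncv.
have DG : dirichlet e (fun i => h i) = dirichlet (@adj G) f.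
  rewrite -(dirichlet_bij f sb se).
  by apply: eq_bigr => i _; apply: eq_bigr => j _; rewrite /= !sE.
have h0 : \sum_(i < n) h i = 0.
  by rewrite -[RHS]f0 -(sum_bij f sb); apply: eq_bigr => i _; rewrite sE.
have hsq : \sum_(i < n) h i ^+ 2 = \sum_x f x ^+ 2.
  by rewrite -(sum_bij (fun y => f y ^+ 2) sb); apply: eq_bigr => i _; rewrite sE.
have Zn : (1 < #|zigzag_graph n|)%N by rewrite card_ord.
have [_ Zle Zeq] := algebraic_connectivity_spectrum R Zn.
have le1 : algebraic_connectivity R (cycle_graph n) * (\sum_x f x ^+ 2) *+ 2 <=
    dirichlet (@zigzag n) (fun i => h i).
  by rewrite -hsq cycleE; exact: Zle.
have le2 := zigzag_dirichlet_le hmono n3 esym encv.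
rewrite DG (fiedler_dirichlet fE) in le2.
have sq0 := sum_sqr_gt0 fx.
split.
  have le12 := le_trans le1 le2.
  rewrite (ler_pMn2r (isT : (0 < 2)%N)) in le12.
  rewrite (ler_pM2r sq0) in le12.
  exact: le12.
move=> aE u u3.
have eqD : dirichlet (@zigzag n) (fun i => h i) = dirichlet e (fun i => h i).
  by apply/le_anti; rewrite DG (fiedler_dirichlet fE) le2 aE le1.
have hE := Zeq (fun i => h i) h0; rewrite hsq -cycleE in hE.
have {}hE : forall i : 'I_n, graph_laplacian (@zigzag n) (fun j => h j) i =
    algebraic_connectivity R (cycle_graph n) * h i.
  by apply: hE; rewrite [LHS]eqD DG (fiedler_dirichlet fE) aE.
have [t sK tK] := sb.
have degE i : deg e i = deg (@adj G) (s i).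
  rewrite /deg [RHS](reindex s) /=; last exact: onW_bij.
  by [].
have hx : exists i : 'I_n, h i != 0 by exists (t x); rewrite -sE tK.
have [||v uv v3] := degree3_neighbour hmono n3 esym encv eirr eqD _ (u := t u).
- by move=> k kn; apply: (sorted_eigen_no_plateau n3 hmono hE).
- by rewrite degE tK.
by exists (s v); [move: uv; rewrite /e tK | rewrite -degE].
Qed.
End Main.

(** * Paths of a theta-graph *)

Section Theta.
Variable G : sgraph.
Implicit Types (u v x y : G) (p q : seq G).

Lemma path_crosses_cut (e : rel G) (S : pred G) x p :
  path e x p -> S x -> ~~ S (last x p) ->
  exists y z, [/\ y \in x :: p, z \in x :: p, S y, ~~ S z & e y z].
Proof.
elim: p x => [|a p IHp] x /=; first by move=> _ ->.
case/andP=> xa ap Sx Sl; have [Sa|Sa] := boolP (S a); last first.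
  by exists x, a; rewrite !inE !eqxx orbT.
have [y [z [yp zp Sy Sz yz]]] := IHp a ap Sa Sl.
by exists y, z; rewrite in_cons yp in_cons zp !orbT.
Qed.

(** Two inner disjoint paths join a vertex of S to a vertex outside S; at most
    one of them meets x, and the other one crosses the boundary of S. *)
Lemma two_connected_no_cut_vertex : two_connected G -> no_cut_vertex (@adj G).
Proof.
move=> [_ conn] x S y0 z0 Sy0 Sz0 y0x z0x.
have yz0 : y0 != z0 by apply: contraNneq Sz0 => <-.
have /existsP[P /andP[/andP[Ppath Pdisj] P2]] : [exists P : {set #|G|.-bseq G},
    [forall p in P, is_path y0 z0 p] &&
    [forall p in P, forall q in P, (p != q) ==> inner_disjoint y0 z0 p q] && (1 < #|P|)].
  apply: contraLR (conn _ _ yz0); rewrite negb_exists -leqNgt => /forallP h.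
  apply/bigmax_leqP => P PP; have := h P; by rewrite PP -leqNgt.
have [p [q [pP qP pq]]] := card_gt1P P2.
have disj : inner_disjoint y0 z0 p q.
  by move/forall_inP/(_ p pP)/forall_inP/(_ q qP)/implyP: Pdisj; apply.
have [w wP xw] : exists2 w : #|G|.-bseq G, w \in P & x \notin val w.
  have [xp|] := boolP (x \in val p); last by exists p.
  exists q => //; apply/negP=> xq; move/allP/(_ x xp): disj.
  by rewrite xq /= eq_sym (negPf y0x) eq_sym (negPf z0x).
have : is_path y0 z0 (val w) := forall_inP Ppath w wP.
case: (val w) xw => [//|a r] xw /= /and4P[/eqP ay pathr /eqP lastr _].
rewrite ay in pathr lastr xw.
have [||y [z [yr zr Sy Sz yz]]] := path_crosses_cut pathr (S := S).
- by [].
- by rewrite lastr.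
by exists y, z; split=> //; apply: contraNneq xw => <-.
Qed.

Lemma path_edgeP p x y x0 : reflect
  (exists2 k, k.+1 < size p & (x, y) = (nth x0 p k, nth x0 p k.+1) \/
                              (y, x) = (nth x0 p k, nth x0 p k.+1))
  (path_edge p x y).
Proof.
have zipP a b : reflect (exists2 k, k.+1 < size p & (a, b) = (nth x0 p k, nth x0 p k.+1))
    ((a, b) \in zip p (behead p)).
  have sz k : (k < size (zip p (behead p))) = (k.+1 < size p).
    by rewrite size_zip size_behead -ltn_predRL leq_min andbC andb_idr // => h;
      exact: leq_trans h (leq_pred _).
  have nz k : k.+1 < size p ->
      nth (x0, x0) (zip p (behead p)) k = (nth x0 p k, nth x0 p k.+1).
    by move=> kp; rewrite nth_zip_cond sz kp nth_behead.
  apply: (iffP (nthP (x0, x0))) => -[k]; rewrite ?sz => kp E; exists k; rewrite ?sz //.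
    by rewrite -nz.
  by rewrite nz.
apply: (iffP orP) => [[/zipP[k kp E]|/zipP[k kp E]]|[k kp [E|E]]].
- by exists k => //; left.
- by exists k => //; right.
- by left; apply/zipP; exists k.
- by right; apply/zipP; exists k.
Qed.

Lemma is_pathP u v p x0 : is_path u v p ->
  [/\ 0 < size p, nth x0 p 0 = u, nth x0 p (size p).-1 = v, uniq p &
      forall k, k.+1 < size p -> adj (nth x0 p k) (nth x0 p k.+1)].
Proof.
case: p => [//|a r] /= /and4P[/eqP <- ap /eqP lr ur]; split => //.
  by rewrite -lr (last_nth x0).
by move=> k kr; apply: (pathP x0 ap).
Qed.
End Theta.

Section ThetaPaths.
Variable G : sgraph.
Implicit Types (u v x y : G) (p q : seq G).

(** The body of [theta_graph] with its witnesses as parameters, so that the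
    roles of the three paths can be exchanged. *)
Definition theta_paths u v p1 p2 p3 : Prop :=
  [/\ u != v,
      [/\ is_path u v p1, is_path u v p2 & is_path u v p3],
      [/\ p1 != p2, p1 != p3 & p2 != p3],
      [/\ inner_disjoint u v p1 p2, inner_disjoint u v p1 p3
        & inner_disjoint u v p2 p3]
    & (forall x, [|| x \in p1, x \in p2 | x \in p3]) /\
      (forall x y, adj x y ->
         [|| path_edge p1 x y, path_edge p2 x y | path_edge p3 x y])].

Lemma inner_disjointP u v p q x :
  inner_disjoint u v p q -> x \in p -> x \in q -> x = u \/ x = v.
Proof. by move=> /allP d xp xq; have := d x xp; rewrite xq /= => /orP[]/eqP; auto. Qed.

Lemma inner_disjoint_sym u v p q : inner_disjoint u v p q -> inner_disjoint u v q p.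
Proof.
move=> d; apply/allP=> x xq; apply/implyP=> xp.
by apply/orP; have [->|->] := inner_disjointP d xp xq; [left|right].
Qed.

Lemma theta_paths_swap12 u v p1 p2 p3 :
  theta_paths u v p1 p2 p3 -> theta_paths u v p2 p1 p3.
Proof.
case=> uv [P1 P2 P3] [n12 n13 n23] [d12 d13 d23] [cov edg]; split=> //.
- by rewrite eq_sym.
- by split=> //; exact: inner_disjoint_sym.
- by split=> [x|x y /edg]; [have := cov x|]; rewrite orbCA.
Qed.

Lemma theta_paths_swap23 u v p1 p2 p3 :
  theta_paths u v p1 p2 p3 -> theta_paths u v p1 p3 p2.
Proof.
case=> uv [P1 P2 P3] [n12 n13 n23] [d12 d13 d23] [cov edg]; split=> //.
- by rewrite (eq_sym p3).
- by split=> //; exact: inner_disjoint_sym.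
- split=> [x|x y /edg]; first by rewrite [(x \in p3) || _]orbC; exact: cov.
  by rewrite [path_edge p3 _ _ || _]orbC.
Qed.

Lemma path_edge_nth p x0 k y : uniq p -> k < size p -> path_edge p (nth x0 p k) y ->
  (0 < k /\ y = nth x0 p k.-1) \/ (k.+1 < size p /\ y = nth x0 p k.+1).
Proof.
move=> up kp /(path_edgeP _ _ _ x0)[j jp [[/eqP] | [yE /eqP]]].
  by rewrite nth_uniq ?(ltnW jp) // => /eqP -> ->; right.
by rewrite nth_uniq ?(ltnW jp) // => /eqP ->; left.
Qed.

Lemma path_edge_mem p x y : path_edge p x y -> x \in p.
Proof.
by move/(path_edgeP _ _ _ x)=> [j jp [[-> _]|[_ ->]]]; apply: mem_nth => //; exact: ltnW.
Qed.

Lemma degree_card (x : G) : deg (@adj G) x = #|[pred y | adj x y]|.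
Proof.
by rewrite /deg -sum1_card [RHS]big_mkcond; apply: eq_bigr => y _; rewrite inE; case: adj.
Qed.

Lemma nth_inj_uniq p x0 i j : uniq p -> i < size p -> j < size p ->
  nth x0 p i = nth x0 p j -> i = j.
Proof. by move=> up ip jp /eqP; rewrite nth_uniq // => /eqP. Qed.

Lemma inner_vertex_neq u v p k : is_path u v p -> 0 < k -> k.+1 < size p ->
  nth u p k <> u /\ nth u p k <> v.
Proof.
move=> /(is_pathP u)[sp pu pv up _] k0 k1.
split=> E.
  suff : k = 0 by lia.
  by apply: (nth_inj_uniq (x0 := u) up); rewrite ?E ?pu //; lia.
suff : k = (size p).-1 by lia.
by apply: (nth_inj_uniq (x0 := u) up); rewrite ?E ?pv //; lia.
Qed.

(** An inner vertex of p1 lies on no other path, so its edges lie on p1 and lead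
    to its predecessor or its successor there. *)
Lemma inner_degree u v p1 p2 p3 k : theta_paths u v p1 p2 p3 ->
  0 < k -> k.+1 < size p1 -> deg (@adj G) (nth u p1 k) <= 2.
Proof.
case=> uv [P1 _ _] _ [d12 d13 _] [_ edg] k0 k1.
have [_ _ _ up1 _] := is_pathP u P1.
have kp := ltnW k1; have xp1 := mem_nth u kp.
have [xu xv] := inner_vertex_neq P1 k0 k1.
set x := nth u p1 k in xp1 xu xv *.
have xuv : x = u \/ x = v -> False by case.
rewrite degree_card; apply: leq_trans (card_size [:: nth u p1 k.-1; nth u p1 k.+1]).
apply/subset_leq_card/subsetP=> y; rewrite !inE => /edg/or3P[].
- by move/path_edge_nth => /(_ up1 kp)[[_ ->]|[_ ->]]; rewrite eqxx ?orbT.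
- by move/path_edge_mem/(inner_disjointP d12 xp1)/xuv.
- by move/path_edge_mem/(inner_disjointP d13 xp1)/xuv.
Qed.

Lemma second_vertex_neq u v p1 p2 : is_path u v p1 -> inner_disjoint u v p1 p2 ->
  2 < size p1 -> 1 < size p2 -> nth u p1 1 != nth u p2 1.
Proof.
move=> P1 d12 s1 s2; apply/eqP=> E.
have [xu xv] := inner_vertex_neq P1 (ltn0Sn 0) s1.
have x1 : nth u p1 1 \in p1 by rewrite mem_nth // ltnW.
have x2 : nth u p1 1 \in p2 by rewrite E mem_nth.
by case: (inner_disjointP d12 x1 x2).
Qed.

Lemma branch_degree u v p1 p2 p3 : theta_paths u v p1 p2 p3 ->
  2 < size p1 -> 2 < size p2 -> 2 < size p3 ->
  deg (@adj G) u = 3 /\ forall y, adj u y -> deg (@adj G) y <= 2.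
Proof.
move=> th s1 s2 s3.
have th2 := theta_paths_swap12 th.
have th3 := theta_paths_swap12 (theta_paths_swap23 th).
case: (th) => uv [P1 P2 P3] _ [d12 d13 d23] [_ edg].
have nbr p y : is_path u v p -> path_edge p u y -> y = nth u p 1.
  move=> /(is_pathP u)[sp pu _ up _]; rewrite -{1}pu => /path_edge_nth => /(_ up sp)[[]|[]] //.
have adj1 p : is_path u v p -> 2 < size p -> adj u (nth u p 1).
  move=> /(is_pathP u)[sp pu _ up pe] s; rewrite -{1}pu; apply: pe; lia.
have nb y : adj u y -> [\/ y = nth u p1 1, y = nth u p2 1 | y = nth u p3 1].
  by move/edg/or3P=> [/nbr->|/nbr->|/nbr->]; auto using Or31, Or32, Or33.
split; last first.
  move=> y /nb[] ->; [exact: inner_degree th _ s1 | exact: inner_degree th2 _ s2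
                     | exact: inner_degree th3 _ s3].
pose s := [:: nth u p1 1; nth u p2 1; nth u p3 1].
rewrite degree_card (_ : #|_| = #|s|).
  apply/card_uniqP; rewrite /= !inE negb_or.
  by rewrite !(second_vertex_neq (v := v)) // ltnW.
apply: eq_card => y; rewrite !inE; apply/idP/idP => [/nb[] ->|]; rewrite ?eqxx ?orbT //.
by case/or3P=> /eqP ->; exact: adj1.
Qed.

End ThetaPaths.

(** * Cycles with a chord *)

Section ChordCycle.
Variables (G : sgraph) (u v : G) (p1 p2 p3 : seq G) (m t : nat).
Let L2 := (size p2).-1.
Let L3 := (size p3).-1.
Hypotheses (th : theta_paths u v p1 p2 p3) (p1_edge : size p1 = 2).
Hypotheses (mE : m.+1 = L2 + L3) (tL : t < L3).

(** The Hamiltonian cycle formed by p2 and p3, read from the vertex that the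
    isomorphism sends to 0: t steps along p3 back to u, then along p2 from u
    to v, then back along p3 from v. *)
Definition chord_walk (i : nat) : G :=
  if i < t then nth u p3 (t - i)
  else if i <= t + L2 then nth u p2 (i - t)
  else nth u p3 (m.+1 + t - i).

(** The position on the walk of the k-th vertex of p3. *)
Let back (k : nat) := if k <= t then t - k else m.+1 + t - k.

Let P2 : is_path u v p2. Proof. by case: th => _ []. Qed.
Let P3 : is_path u v p3. Proof. by case: th => _ []. Qed.
Let s2 : size p2 = L2.+1.
Proof. by have [sp _ _ _ _] := is_pathP u P2; rewrite /L2 prednK. Qed.
Let s3 : size p3 = L3.+1.
Proof. by have [sp _ _ _ _] := is_pathP u P3; rewrite /L3 prednK. Qed.
Let p1E : p1 = [:: u; v].
Proof.
case: th => _ [+ _ _] _ _ _; case: p1 p1_edge => [//|a [//|b [|//]]] _.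
by case/and4P=> /eqP-> _ /eqP <-.
Qed.

Lemma chord_walk_front k : k <= L2 -> chord_walk (t + k) = nth u p2 k.
Proof. by move=> k2; rewrite /chord_walk ltnNge leq_addr leq_add2l k2 addKn. Qed.

Lemma chord_walk_back k : k <= L3 -> chord_walk (back k) = nth u p3 k.
Proof.
move=> k3; have [_ p2u p2v _ _] := is_pathP u P2; have [_ p3u p3v _ _] := is_pathP u P3.
have [k0|k0] := posnP k.
  by rewrite k0 p3u -p2u -(chord_walk_front (leq0n _)) /back leq0n subn0 addn0.
have [kt|kt] := leqP k t.
  rewrite /back kt /chord_walk; have -> : t - k < t by lia.
  by congr (nth u p3); lia.
rewrite /back leqNgt kt /=; have [kL|kL] := eqVneq k L3.
  have -> : m.+1 + t - k = t + L2 by lia.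
  by rewrite chord_walk_front // kL p2v p3v.
rewrite /chord_walk.
have -> : (m.+1 + t - k < t) = false by lia.
have -> : (m.+1 + t - k <= t + L2) = false by lia.
by congr (nth u p3); lia.
Qed.

Let p3_inner k : 0 < k -> k < L3 -> nth u p3 k \notin p2.
Proof.
move=> k0 k3; apply/negP=> k2; have k1s : k.+1 < size p3 by rewrite s3.
have [xu xv] := inner_vertex_neq P3 k0 k1s.
case: th => _ _ _ [_ _ d23] _.
have kp : nth u p3 k \in p3 by rewrite mem_nth // s3; lia.
by case: (inner_disjointP d23 k2 kp).
Qed.

Lemma chord_walkP i : i <= m ->
  (exists2 k, k <= L2 & i = t + k) \/ (exists2 k, 0 < k < L3 & i = back k).
Proof.
move=> im; have [it|it] := ltnP i t.
  by right; exists (t - i); rewrite /back; [lia | case: ifP; lia].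
have [itL|itL] := leqP i (t + L2); first by left; exists (i - t); lia.
right; exists (m.+1 + t - i); first by lia.
by rewrite /back; case: ifP; lia.
Qed.

Lemma chord_walk_inj i j : i <= m -> j <= m -> chord_walk i = chord_walk j -> i = j.
Proof.
have [_ _ _ up2 _] := is_pathP u P2; have [_ _ _ up3 _] := is_pathP u P3.
have mixed k l : k <= L2 -> 0 < l < L3 -> nth u p2 k = nth u p3 l -> False.
  move=> k2 /andP[l0 l3] E; have /negP := p3_inner l0 l3; apply.
  by rewrite -E mem_nth // s2.
move=> /chord_walkP[] [k kk ->] /chord_walkP[] [l ll ->];
  rewrite ?chord_walk_front ?chord_walk_back //; try lia.
- by move/(nth_inj_uniq up2) => ->; rewrite ?s2.
- by move/(mixed _ _ kk ll).
- by move/esym/(mixed _ _ ll kk).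
- by move/(nth_inj_uniq up3) => ->; rewrite ?s3 //; lia.
Qed.

Lemma back_lt k : k <= L3 -> back k <= m.
Proof. by move=> k3; rewrite /back; case: ifP; lia. Qed.

Lemma chord_walk_onto x : exists2 i, i <= m & chord_walk i = x.
Proof.
have L2m : t + L2 <= m by lia.
have from2 y : y \in p2 -> exists2 i, i <= m & chord_walk i = y.
  move=> yp; have := yp; rewrite -index_mem s2 ltnS => il.
  exists (t + index y p2); first by lia.
  by rewrite chord_walk_front // nth_index.
have [_ p2u p2v _ _] := is_pathP u P2.
case: th => _ _ _ _ [cov _]; case/or3P: (cov x) => [|/from2 //|xp].
  rewrite p1E !inE => /orP[] /eqP ->; apply: from2.
    by rewrite -p2u mem_nth // s2.
  by rewrite -[X in X \in _]p2v mem_nth // s2.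
have := xp; rewrite -index_mem s3 ltnS => il.
exists (back (index x p3)); first exact: back_lt.
by rewrite chord_walk_back // nth_index.
Qed.

Lemma chord_walk_adj i : i <= m -> adj (chord_walk i) (chord_walk (i.+1 %% m.+1)).
Proof.
have [_ _ _ _ e2] := is_pathP u P2; have [_ _ _ _ e3] := is_pathP u P3.
move=> im; have [/andP[ti it]|out] := boolP ((t <= i) && (i < t + L2)).
  rewrite modn_small; last by lia.
  have -> : i.+1 = t + (i - t).+1 by lia.
  have {1}-> : i = t + (i - t) by lia.
  by rewrite !chord_walk_front; [apply: e2; rewrite s2|..]; lia.
pose k := if i < t then (t - i).-1 else m + t - i.
have k3 : k < L3 by rewrite /k; case: ifP; lia.
have -> : i = back k.+1 by rewrite /back /k; do ![case: ifP]; lia.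
have -> : (back k.+1).+1 %% m.+1 = back k.
  have [kt|kt] := leqP k.+1 t; first by rewrite /back kt (ltnW kt) modn_small; lia.
  rewrite /back leqNgt kt /=; have [kt'|kt'] := leqP k t.
    by have -> : (m.+1 + t - k.+1).+1 = m.+1; [lia | rewrite modnn; lia].
  by rewrite modn_small; lia.
rewrite !chord_walk_back ?(ltnW k3) // adj_sym; apply: e3; rewrite s3; lia.
Qed.

(** The three paths contribute the three kinds of edges: p1 the chord, p2 and p3
    the edges of the cycle. *)
Lemma chord_walk_edge i j : i <= m -> j <= m -> adj (chord_walk i) (chord_walk j) ->
  [\/ j = i.+1 %% m.+1, i = j.+1 %% m.+1, i = t /\ j = t + L2 | i = t + L2 /\ j = t].
Proof.
move=> im jm; case: th => _ _ _ _ [_ edg] /edg.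
have [_ p2u p2v _ _] := is_pathP u P2.
have L2m : t + L2 <= m by lia.
have ut : u = chord_walk t by rewrite -[t]addn0 chord_walk_front // p2u.
have vt : v = chord_walk (t + L2) by rewrite chord_walk_front // p2v.
have tm : t <= m by lia.
case/or3P.
- rewrite p1E /path_edge /= !inE !xpair_eqE ut vt.
  case/orP=> /andP[/eqP/chord_walk_inj E1 /eqP/chord_walk_inj E2].
    by apply: Or43; split; [apply: E1 | apply: E2].
  by apply: Or44; split; [apply: E2 | apply: E1].
- case/(path_edgeP _ _ _ u)=> k; rewrite s2 => k2 E.
  have [a b] : t + k <= m /\ t + k.+1 <= m by lia.
  rewrite -!chord_walk_front in E; try lia.
  have S : t + k.+1 = (t + k).+1 %% m.+1 by rewrite -addnS modn_small; lia.
  case: E => -[/chord_walk_inj E1 /chord_walk_inj E2].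
    by apply: Or41; rewrite (E1 im a) (E2 jm b).
  by apply: Or42; rewrite (E1 jm a) (E2 im b).
- case/(path_edgeP _ _ _ u)=> k; rewrite s3 => k3 E.
  have [a b] : back k <= m /\ back k.+1 <= m by split; apply: back_lt; lia.
  rewrite -!chord_walk_back in E; try lia.
  have S : back k = (back k.+1).+1 %% m.+1.
    rewrite {}/back in a b *.
    have [kt|kt] := leqP k.+1 t; first by rewrite (ltnW kt) modn_small; lia.
    have [kt'|kt'] := leqP k t.
      by have -> : (m.+1 + t - k.+1).+1 = m.+1; [lia | rewrite modnn; lia].
    by rewrite modn_small; lia.
  case: E => -[/chord_walk_inj E1 /chord_walk_inj E2].
    by apply: Or42; rewrite (E1 im a) (E2 jm b).
  by apply: Or41; rewrite (E1 jm a) (E2 im b).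
Qed.

Lemma chord_walk_isomorphic : isomorphic (cycle_chord m.+1 t (t + L2)) G.
Proof.
have inj : injective (fun i : 'I_m.+1 => chord_walk i).
  by move=> i j /chord_walk_inj E; apply/val_inj/E; rewrite -ltnS.
have onto x : exists i : 'I_m.+1, chord_walk i == x.
  have [i im <-] := chord_walk_onto x.
  by rewrite -ltnS in im; exists (Ordinal im).
exists (fun i : 'I_m.+1 => chord_walk i).
  exists (fun x => xchoose (onto x)) => [i|x]; last exact/eqP/(xchooseP (onto x)).
  by apply: inj; apply/eqP/(xchooseP (onto (chord_walk i))).
have [L2m tm] : t + L2 < m.+1 /\ t < m.+1 by lia.
have [_ p2u p2v _ _] := is_pathP u P2.
have uv : adj u v.
  by case: th => _ [/(is_pathP u)[_ _ _ _ e1] _ _] _ _ _; have := e1 0; rewrite p1E; apply.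
have ut : chord_walk t = u by rewrite -[t]addn0 chord_walk_front.
have vt : chord_walk (t + L2) = v by rewrite chord_walk_front.
move=> i j; rewrite /= /add_edge_rel /= /cycle_rel -!val_eqE /= !inordK //.
have [im jm] : i <= m /\ j <= m by split; rewrite -ltnS.
apply/idP/idP.
  move=> ij; have ne : val i != val j.
    by apply: contraTneq ij => ->; rewrite adj_irrefl.
  rewrite ne /=; case: (chord_walk_edge im jm ij) => [->|->|[-> ->]|[-> ->]];
    by rewrite !eqxx ?orbT.
case/orP=> /andP[_ /orP[]].
- by move/eqP=> ->; exact: chord_walk_adj.
- by move/eqP=> ->; rewrite adj_sym; exact: chord_walk_adj.
- by case/andP=> /eqP -> /eqP ->; rewrite ut vt.
- by case/andP=> /eqP -> /eqP ->; rewrite ut vt adj_sym.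
Qed.
End ChordCycle.

Lemma path_size_gt1 (G : sgraph) (u v : G) p : u != v -> is_path u v p -> 1 < size p.
Proof.
move=> uv /(is_pathP u)[sp pu pv _ _]; case: p sp pu pv => [//|a [|//]] _ /= au av.
by rewrite -au -av eqxx in uv.
Qed.

Lemma path_size2 (G : sgraph) (u v : G) p : is_path u v p -> size p = 2 -> p = [:: u; v].
Proof.
by case: p => [//|a [//|b [|//]]] /and4P[/eqP-> _ /eqP <- _].
Qed.

(** The single edge p1 is a chord of the cycle formed by p2 and p3, and the
    chord can be placed at any position t that keeps the chosen arc from
    wrapping around 0. *)
Lemma theta_chord (G : sgraph) (u v : G) (p1 p2 p3 : seq G) :
  theta_paths u v p1 p2 p3 -> size p1 = 2 ->
  exists a b, [/\ 1 < a, 1 < b, #|G| = a + b &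
    (forall t, t < b -> isomorphic G (cycle_chord #|G| t (t + a))) /\
    (forall t, t < a -> isomorphic G (cycle_chord #|G| t (t + b)))].
Proof.
move=> th s1; have th' := theta_paths_swap23 th.
have [uv [P1 P2 P3] [n12 n13 _] _ _] := th.
have long p : is_path u v p -> p1 != p -> 1 < (size p).-1.
  move=> P ne; have := path_size_gt1 uv P; rewrite ltn_predRL leq_eqVlt.
  case/predU1P => [/esym s|//].
  by rewrite (path_size2 P s) (path_size2 P1 s1) eqxx in ne.
have [l2 l3] := (long p2 P2 n12, long p3 P3 n13).
set a := (size p2).-1 in l2 *; set b := (size p3).-1 in l3 *.
have mE : (a + b).-1.+1 = a + b by rewrite prednK // addn_gt0 (ltnW l2).
have Gab : #|G| = a + b.
  have [g gb _] := chord_walk_isomorphic (t := 0) th s1 mE (ltnW l3).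
  by rewrite -(bij_eq_card gb) card_ord.
exists a, b; rewrite Gab; split=> //; split=> t tb; apply: isomorphic_sym.
  by have := chord_walk_isomorphic th s1 mE tb; rewrite mE.
by have := chord_walk_isomorphic th' s1; rewrite addnC => /(_ _ _ mE tb); rewrite mE.
Qed.

(** As n is odd, exactly one arc is odd; placing it in the middle of 0..n-1
    leaves even room b, split evenly by i = b / 2. *)
Lemma chord_H1 n (G : sgraph) a b : odd n -> n = a + b -> 1 < a -> 1 < b ->
  (forall t, t < b -> isomorphic G (cycle_chord n t (t + a))) ->
  (forall t, t < a -> isomorphic G (cycle_chord n t (t + b))) ->
  exists2 i : nat, 1 <= i <= (n - 3) %/ 2 & isomorphic G (H1 n i).
Proof.
wlog oa : a b / odd a.
  move=> h on nab a1 b1 Ia Ib; have [oa|ea] := boolP (odd a); first exact: (h a b).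
  by apply: (h b a) => //; [lia | rewrite nab addnC].
move=> on nab a1 b1 Ia _; exists b./2; first by lia.
rewrite /H1 (_ : n - b./2 = b./2 + a); last by lia.
by apply: Ia; lia.
Qed.

(** The two arcs have the same parity: H_2 is the even case and H_3 the odd
    one, with i = b / 2 rounded down in both cases. *)
Lemma chord_H2_H3 n (G : sgraph) a b : ~~ odd n -> n = a + b -> 1 < a -> 1 < b ->
  (forall t, t < b -> isomorphic G (cycle_chord n t (t + a))) ->
  (exists2 i : nat, 1 <= i <= (n - 2) %/ 2 & isomorphic G (H2 n i)) \/
  (exists2 i : nat, 1 <= i <= (n - 4) %/ 2 & isomorphic G (H3 n i)).
Proof.
move=> en nab a1 b1 Ia; have I : isomorphic G (cycle_chord n b./2 (b./2 + a)).
  by apply: Ia; lia.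
have [oa|ea] := boolP (odd a); [right|left]; exists b./2; try lia.
  by rewrite /H3 (_ : n - b./2 - 1 = b./2 + a); last lia.
by rewrite /H2 (_ : n - b./2 = b./2 + a); last lia.
Qed.

Theorem theorem1p2 (R : realType) (n : nat) (G : sgraph)
    (n_ge4 : 4 <= n) (G_order : #|G| = n) (G_theta : theta_graph G) :
  [/\ (algebraic_connectivity R (cycle_graph n) <= algebraic_connectivity R G)%R,
      odd n ->
        algebraic_connectivity R G = algebraic_connectivity R (cycle_graph n) ->
        exists2 i : nat, 1 <= i <= (n - 3) %/ 2 & isomorphic G (H1 n i)
    & ~~ odd n ->
        algebraic_connectivity R G = algebraic_connectivity R (cycle_graph n) ->
        (exists2 i : nat, 1 <= i <= (n - 2) %/ 2 & isomorphic G (H2 n i)) \/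
        (exists2 i : nat, 1 <= i <= (n - 4) %/ 2 & isomorphic G (H3 n i))].
Proof.
have [conn [u [v [p1 [p2 [p3 th]]]]]] := G_theta.
have {}th : theta_paths u v p1 p2 p3 by [].
have [le_alpha eq_alpha] :=
  connectivity_vs_cycle R G_order (ltnW n_ge4) (two_connected_no_cut_vertex conn).
have [uv [P1 P2 P3] _ _ _] := th.
have chord : algebraic_connectivity R G = algebraic_connectivity R (cycle_graph n) ->
    exists q1 q2 q3, theta_paths u v q1 q2 q3 /\ size q1 = 2.
  move=> aE; have [s1|s1] := eqVneq (size p1) 2; first by exists p1, p2, p3.
  have [s2|s2] := eqVneq (size p2) 2.
    by exists p2, p1, p3; split=> //; exact: theta_paths_swap12.
  have [s3|s3] := eqVneq (size p3) 2.
    exists p3, p1, p2; split=> //.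
    exact/theta_paths_swap12/theta_paths_swap23.
  have long p : is_path u v p -> size p != 2 -> 2 < size p.
    by move=> P ne; rewrite ltn_neqAle eq_sym ne (path_size_gt1 uv P).
  have [u3 nbr2] := branch_degree th (long _ P1 s1) (long _ P2 s2) (long _ P3 s3).
  have [w uw w3] := eq_alpha aE u u3.
  by have := nbr2 w uw; rewrite w3.
split=> // par /chord[q1 [q2 [q3 [/theta_chord thc /thc]]]];
  rewrite G_order => -[a [b [a1 b1 nab [Ia Ib]]]].
- exact: chord_H1 par nab a1 b1 Ia Ib.
- exact: chord_H2_H3 par nab a1 b1 Ia.
Qed.
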